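(* Let $X$ be a real Banach space of dimension greater than one and let $T:X\rightrightarrows X^*$ be a (non-empty) monotone operator whose domain $D(T)$ is nearly-convex and not a singleton. Then $T$ is maximal monotone if and only if all of the following hold: (C) $T=T+N_{D(T)}$; (H') for every $x\in D(T)$ the set $T(x)$ is weak-star closed and convex, and for every $x\in\overline{D(T)}\setminus\operatorname{ri}D(T)$ and every $v\in\operatorname{ri}T_{\overline{D(T)}}(x)$, $$\inf_{h>0}\ \inf_{x^*\in T(x+hv)}\langle v,x^*\rangle\ \le\ \sup_{x^*\in T(x)}\langle v,x^*\rangle;$$ (D') $T$ is demiclosed on $\operatorname{ri}D(T)$.
   Context: $X^*$ is the topological dual of $X$, $\langle x,x^*\rangle:=x^*(x)$, and closures in $X$ are in norm. A multifunction $T:X\rightrightarrows X^*$ is identified with its graph $\{(x,x^* )\mid x^*\in T(x)\}$; its domain is $D(T)=\{x\mid T(x)\neq\emptyset\}$. $T$ is monotone if $\langle x_1-x_2,x_1^*-x_2^*\rangle\ge0$ for all $(x_1,x_1^* ),(x_2,x_2^* )\in T$; it is maximal monotone if it is monotone and its graph is not properly contained in the graph of another monotone operator $X\rightrightarrows X^*$. Sums are pointwise. For $C\subset X$, $N_C(x)=\{x^*\in X^*\mid\langle y-x,x^*\rangle\le0\ \forall y\in C\}$ if $x\in C$, $N_C(x)=\emptyset$ otherwise. For $S\subset X$, $\operatorname{ri}S$ is the interior of $S$ relative to the norm closure of its affine hull. $S$ is nearly-convex if there is a convex set $C$ with $\operatorname{ri}C\neq\emptyset$ and $C\subset S\subset\overline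 C$. For a convex set $C$ and $x\in\overline C$, $T_C(x)$ denotes the tangent cone to $C$ at $x$, i.e. the closure of $\bigcup_{h>0}h(C-x)$ (unrelated to the operator $T$). $T$ is demiclosed on a set $S\subset\overline{D(T)}$ if whenever $(x_i,x_i^* )_i$ is a net in the graph of $T$ with $x_i\to x$ in norm, $x_i^*\to x^*$ weakly-star, $(x_i^* )_i$ norm bounded and $x\in S$, one has $(x,x^* )\in T$. Conventions: $\sup\emptyset=-\infty$, $\inf\emptyset=+\infty$. *)

(* Defs.v *)
From HB Require Import structures.
From mathcomp Require Import all_boot all_order all_algebra.
From mathcomp Require Import all_classical all_reals all_analysis.

Set Implicit Arguments.
Unset Strict Implicit.
Unset Printing Implicit Defensive.

Import Order.TTheory GRing.Theory Num.Theory.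
Import numFieldNormedType.Exports.

Local Open Scope classical_set_scope.
Local Open Scope ring_scope.

Section Dual.
Context {R : realType} (X : normedModType R).

Definition is_dual : {pred X -> R^o} :=
  fun f => `[< linear f /\ continuous f >].

Lemma is_dual_submod_closed : submod_closed is_dual.
Proof.
split=> [|a f g /asboolP[lf cf] /asboolP[lg cg]]; apply/asboolP; split.
- by move=> c x y /=; rewrite scaler0 addr0.
- by move=> x; exact: cvg_cst.
- move=> c x y; rewrite !fctE lf lg !scalerDr !scalerA (mulrC a c).
  by rewrite addrACA.
- by move=> x; apply: cvgD; [apply: cvgZl_tmp; exact: cf|exact: cg].
Qed.

HB.instance Definition _ :=
  GRing.isSubmodClosed.Build R (X -> R^o) is_dual is_dual_submod_closed.

Record dual := Dual { dual_fun : X -> R^o; dual_funP : dual_fun \in is_dual }.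

HB.instance Definition _ := [isSub for dual_fun].
HB.instance Definition _ := [Choice of dual by <:].
HB.instance Definition _ := [SubChoice_isSubLmodule of dual by <:].

Definition pairing (x : X) (f : dual) : R := dual_fun f x.

(* The supremum is over a bounded set because f is continuous. *)
Definition dual_norm (f : dual) : R :=
  sup [set `|pairing x f| | x in [set x | `|x| <= 1]].

Definition weak_star : Type :=
  initial_topology (dual_fun : dual -> {ptws X -> R^o}).

HB.instance Definition _ := Topological.on weak_star.

End Dual.

Notation "<[ x , f ]>" := (pairing x f) (format "<[ x ,  f ]>") : ring_scope.

Section ConvexGeometry.
Context {R : realType} {X : normedModType R}.
Implicit Types (S C : set X) (x : X).

Definition affine_set S :=
  forall x y (t : R), S x -> S y -> S ((1 - t) *: x + t *: y).

Definition affine_hull S : set X := smallest affine_set S.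

(* Points off the closed affine hull are isolated in the subspace type, but
   they are not in S, hence not in this interior. *)
Definition ri S : set X :=
  @interior (subspace (closure (affine_hull S))) S.

Definition nearly_convex S :=
  exists C : set X,
    [/\ convex_set C, ri C !=set0, C `<=` S & S `<=` closure C].

Definition tangent_cone C x : set X :=
  closure (\bigcup_(h in [set h : R | 0 < h]) [set h *: (y - x) | y in C]).

Definition normal_cone C : X -> set (dual X) :=
  fun x => [set f | C x /\ forall y, C y -> <[y - x, f]> <= 0].

Definition dim_gt1 (V : lmodType R) :=
  exists u v : V, forall a b : R, a *: u + b *: v = 0 -> a = 0 /\ b = 0.

End ConvexGeometry.

Section Operators.
Context {R : realType} {X : normedModType R}.
Implicit Types (T : X -> set (dual X)).

Definition domain T : set X := [set x | T x !=set0].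

Definition monotone_op T :=
  forall x1 x2 f1 f2, T x1 f1 -> T x2 f2 -> 0 <= <[x1 - x2, f1 - f2]>.

Definition maximal_monotone T :=
  monotone_op T /\
  forall T', monotone_op T' -> (forall x, T x `<=` T' x) -> T' = T.

Definition sum_op T1 T2 : X -> set (dual X) :=
  fun x => [set f + g | f in T1 x & g in T2 x].

End Operators.

Section Nets.

Definition directed (I : Type) (le : I -> I -> Prop) :=
  [/\ inhabited I, (forall i, le i i),
      (forall i j k, le i j -> le j k -> le i k)
    & (forall i j, exists k, le i k /\ le j k)].

Definition tails (I : Type) (le : I -> I -> Prop) : set_system I :=
  [set A | exists i, forall j, le i j -> A j].

Context {R : realType} {X : normedModType R}.

Definition demiclosed (T : X -> set (dual X)) (S : set X) :=
  forall (I : Type) (le : I -> I -> Prop) (x_ : I -> X) (f_ : I -> dual X)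
         (x : X) (f : dual X),
    directed le ->
    (forall i, T (x_ i) (f_ i)) ->
    x_ @ tails le --> x ->
    (f_ : I -> weak_star X) @ tails le --> (f : weak_star X) ->
    (exists M : R, forall i, dual_norm (f_ i) <= M) ->
    S x ->
    T x f.

End Nets.

(* Main.v *)
(* Necessity.  Let K be the closure of D(T) and Y the closed subspace parallel
   to its affine hull.  If b <= <v, f> for all f in T(x + h v), 0 < h <= s, and
   x + s v lies in ri D(T), then monotonicity bounds the restrictions of these
   f to Y pointwise, hence uniformly by Banach-Steinhaus.  Extending the
   restrictions to X with the same norm stays inside T because the normal cones
   contain the annihilator of Y, so by demiclosedness a weak-star cluster point
   as h -> 0 is some f in T(x) with b <= <v, f>.  This is the inequality in
   (H').

   Sufficiency.  Let (x, f) be monotonically related to T.  By (C), x is in the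
   closed affine hull of D(T).  If x were outside K, a segment from ri D(T) to x
   would leave K at some z; there (H') (when T(z) is empty) or a supporting
   functional at z and (C) (otherwise) give a contradiction.  If x is in K and
   f is not in T(x), separate f from T(x) by some u in X; (C) puts u in the
   tangent cone, and either x is in ri D(T), where the argument above applies to
   u, or a small perturbation of u into the relative interior of the tangent
   cone contradicts (H'). *)

Require Import Defs.
From HB Require Import structures.
From mathcomp Require Import all_boot all_order all_algebra.
From mathcomp Require Import all_classical all_reals all_analysis.
From mathcomp Require Import ring lra.

Import Order.TTheory GRing.Theory Num.Theory.
Import numFieldNormedType.Exports.

Local Open Scope classical_set_scope.
Local Open Scope ring_scope.

Set Implicit Arguments.
Unset Strict Implicit.
Unset Printing Implicit Defensive.

(** * Hahn-Banach separation *)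

Section HahnBanach.
Context {R : realType} {V : lmodType R}.
Implicit Types p q : V -> R.

Definition sublinear p :=
  (forall x y, p (x + y) <= p x + p y) /\
  (forall a x, 0 < a -> p (a *: x) <= a * p x).

(** The inequality for the factor [a^-1] at the point [a *: x] is the reverse bound. *)
Lemma sublinearZ p a x : sublinear p -> 0 < a -> p (a *: x) = a * p x.
Proof.
move=> [_ pZ] a0; apply/eqP; rewrite eq_le pZ//=.
rewrite -ler_pdivlMl//.
by rewrite -{1}[x](scalerK (lt0r_neq0 a0)) pZ// invr_gt0.
Qed.

Lemma sublinear0 p : sublinear p -> p 0 = 0.
Proof.
move=> sp; have := sublinearZ 0 sp (ltr0n R 2); rewrite scaler0 => h.
lra.
Qed.

Lemma sublinear_geN p x : sublinear p -> - p (- x) <= p x.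
Proof.
move=> sp; have := sp.1 x (- x); rewrite subrr sublinear0//; lra.
Qed.

(** For sublinear [p], the choice [t = 1] at [x = - y] gives a value of at most [- p y], so the tilt
    is a sublinear functional below [p] that is linear on the line spanned by [y]. *)
Definition tilt p y x : R :=
  inf [set p (x + t *: y) - t * p y | t in [set t | 0 <= t]].

(** Subadditivity for the sum of [x + t *: y] and [- x] gives the bound [- p (- x)], which makes the
    infimum a genuine one. *)
Let tilt_has_lbound p y x : sublinear p ->
  has_lbound [set p (x + t *: y) - t * p y | t in [set t | 0 <= t]].
Proof.
move=> sp; exists (- p (- x)) => _ [t /= t0 <-].
have pty : p (t *: y) = t * p y.
  move: t0; rewrite le_eqVlt => /predU1P[<-|t0].
    by rewrite scale0r mul0r sublinear0.
  exact: sublinearZ.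
have := sp.1 (x + t *: y) (- x); rewrite addrAC subrr add0r pty; lra.
Qed.

Lemma tilt_le p y x t : sublinear p -> 0 <= t ->
  tilt p y x <= p (x + t *: y) - t * p y.
Proof. by move=> sp t0; apply: ge_inf; [exact: tilt_has_lbound|exists t]. Qed.

Lemma tilt_ge p y x m :
  (forall t, 0 <= t -> m <= p (x + t *: y) - t * p y) -> m <= tilt p y x.
Proof.
move=> h; apply: lb_le_inf; last by move=> _ [t /= t0 <-]; exact: h.
by exists (p (x + 0 *: y) - 0 * p y); exists 0 => /=.
Qed.

Lemma tilt_sublinear p y : sublinear p -> sublinear (tilt p y).
Proof.
move=> sp; split=> [x z|a x a0].
  rewrite -lerBlDr; apply: tilt_ge => s s0; rewrite lerBlDr -lerBlDl.
  apply: tilt_ge => t t0; rewrite lerBlDl.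
  apply: le_trans (tilt_le y (x + z) sp (addr_ge0 s0 t0)) _.
  have := sp.1 (x + s *: y) (z + t *: y); rewrite addrACA -scalerDl; lra.
rewrite -ler_pdivrMl//; apply: tilt_ge => t t0; rewrite ler_pdivrMl//.
apply: le_trans (tilt_le y (a *: x) sp (mulr_ge0 (ltW a0) t0)) _.
by rewrite -scalerA -scalerDr sublinearZ// mulrBr mulrA.
Qed.

Lemma tilt_le_id p y x : sublinear p -> tilt p y x <= p x.
Proof.
by move=> sp; have := tilt_le y x sp (lexx 0); rewrite scale0r mul0r addr0 subr0.
Qed.

(** Bounds a chain from below for Zorn's lemma. Of two members the smaller one serves at both
    points, whence subadditivity; comparison with the member [p] keeps all values at [x] above
    [- p (- x)]. *)
Let inf_total_sublinear (F : set (V -> R)) p :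
  F p -> (forall q, F q -> sublinear q) ->
  (forall q r, F q -> F r -> (forall x, q x <= r x) \/ (forall x, r x <= q x)) ->
  exists q, sublinear q /\ forall r, F r -> forall x, q x <= r x.
Proof.
move=> Fp Fs Ft; pose q x := inf [set r x | r in F].
have lb x : has_lbound [set r x | r in F].
  exists (Num.min (- p (- x)) (p x - p x - p (- x))) => _ [r Fr <-].
  have [h|h] := Ft _ _ Fp Fr.
    by have := sublinear_geN x (Fs _ Fp); have := h x; rewrite ge_min; lra.
  by have := sublinear_geN x (Fs _ Fr); have := h (- x); rewrite ge_min; lra.
have qle r x : F r -> q x <= r x by move=> Fr; apply: ge_inf => //; exists r.
have qge x m : (forall r, F r -> m <= r x) -> m <= q x.
  by move=> h; apply: lb_le_inf; [exists (p x), p|move=> _ [r Fr <-]; exact: h].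
exists q; split; last by move=> r Fr x; exact: qle.
split=> [x y|a x a0].
  rewrite -lerBlDr; apply: (qge) => r Fr; rewrite lerBlDr -lerBlDl.
  apply: (qge) => s Gs; rewrite lerBlDl.
  have [h|h] := Ft _ _ Fr Gs.
    by apply: le_trans (qle _ _ Fr) _; have := (Fs _ Fr).1 x y; have := h y; lra.
  by apply: le_trans (qle _ _ Gs) _; have := (Fs _ Gs).1 x y; have := h x; lra.
rewrite -ler_pdivrMl//; apply: (qge) => r Fr; rewrite ler_pdivrMl//.
exact: le_trans (qle _ _ Fr) ((Fs _ Fr).2 _ _ a0).
Qed.

(* A minimal sublinear functional coincides with all its tilts, hence is
   linear. *)
Lemma sublinear_ge_linear p : sublinear p ->
  exists f : V -> R^o, linear f /\ forall x, f x <= p x.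
Proof.
move=> sp; pose T := {q : V -> R | sublinear q /\ forall x, q x <= p x}.
(* The order is reversed, so that the maximal element from Zorn's lemma is a minimal functional. *)
pose leT (q r : T) : bool := `[< forall x, sval r x <= sval q x >].
have [||||[q [sq qp]] /= qmin] := @Zorn T leT.
- by move=> q; apply/asboolP => x.
- move=> q r s /asboolP qr /asboolP rs; apply/asboolP => x.
  exact: le_trans (rs x) (qr x).
- move=> [q Hq] [r Hr] /asboolP qr /asboolP rq; apply: eq_exist; apply/funext => x.
  by apply/eqP; rewrite eq_le; apply/andP; split; [exact: rq|exact: qr].
- move=> A At; have [[q0 Aq0]|A0] := pselect (A !=set0); last first.
    by exists (exist _ p (conj sp (fun x => lexx (p x)))) => s As; case: A0; exists s.
  have [||q r [q' Aq' <-] [r' Ar' <-]|q [sq qle]] :=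
      @inf_total_sublinear [set sval q | q in A] (sval q0).
  + by exists q0.
  + by move=> _ [q _ <-]; exact: (svalP q).1.
  + by have [/asboolP|/asboolP] := At _ _ Aq' Ar'; [right|left].
  have qp x : q x <= p x.
    by apply: le_trans ((svalP q0).2 x); apply: (qle); exists q0.
  exists (exist _ q (conj sq qp)) => s As; apply/asboolP => x /=.
  by apply: (qle); exists s.
have qtilt y x : q x <= tilt q y x.
  have tp z : tilt q y z <= p z by apply: le_trans (qp z); exact: tilt_le_id.
  pose qy : T := exist _ (tilt q y) (conj (tilt_sublinear y sq) tp).
  have /(congr1 sval) /= -> // : qy = exist _ q (conj sq qp).
  by apply: qmin; apply/asboolP => z /=; exact: tilt_le_id.
(* The tilt with [t = 1] gives superadditivity. *)
have qD x y : q (x + y) = q x + q y.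
  apply/eqP; rewrite eq_le sq.1 /=.
  have := le_trans (qtilt y x) (tilt_le y x sq ler01).
  by rewrite scale1r mul1r lerBrDr.
exists q; split=> // a x y; rewrite qD; congr (_ + _).
have qN z : q (- z) = - q z.
  by apply/eqP; rewrite -addr_eq0 -qD addNr sublinear0.
have [a0|a0|->] := ltgtP a 0; last by rewrite !scale0r sublinear0.
  rewrite -[a]opprK scaleNr qN sublinearZ ?oppr_gt0//.
  by rewrite /GRing.scale /= !mulNr opprK.
by rewrite sublinearZ.
Qed.

Lemma linear_funN (f : V -> R^o) : linear f -> forall x, f (- x) = - f x.
Proof.
move=> lf x; have f0 : f 0 = 0 :> R.
  by have := lf 1 0 0; rewrite scaler0 scale1r addr0; lra.
by have := lf (- 1) x 0; rewrite f0 !addr0 !scaleN1r.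
Qed.

Lemma convex_setP (C : set V) : convex_set C <->
  forall x y (s t : R), 0 <= s -> 0 <= t -> s + t = 1 -> C x -> C y ->
    C (s *: x + t *: y).
Proof.
split=> [cC x y s t s0 t0 st Cx Cy|cC].
  have s1 : s <= 1 by lra.
  have -> : t = 1 - s by lra.
  by have := cC x y (Itv01 s0 s1); rewrite !inE; apply.
move=> x y l; rewrite !inE => Cx Cy.
have l0 : 0 <= l%:num by [].
have l1 : 0 <= 1 - l%:num :> R by rewrite subr_ge0.
by apply: (cC x y l%:num (1 - l%:num)) => //; rewrite addrCA subrr addr0.
Qed.

(* The functional is dominated by [x |-> inf (N (x + t c) - t)] over [t >= 0] and
   [c] in [C]. *)
Lemma separate_convex (N : V -> R) (C : set V) : sublinear N ->
  convex_set C -> C !=set0 -> (forall c, C c -> 1 <= N c) ->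
  exists f : V -> R^o,
    [/\ linear f, forall x, f x <= N x & forall c, C c -> 1 <= f c].
Proof.
move=> sN /convex_setP cC [c0 Cc0] NC.
pose S x := [set N (x + z.1 *: z.2) - z.1 | z in [set z | 0 <= z.1 /\ C z.2]].
pose p x := inf (S x).
have ple x t c : 0 <= t -> C c -> p x <= N (x + t *: c) - t.
  move=> t0 Cc; apply: ge_inf; last by exists (t, c).
  exists (- N (- x)) => _ [[s d] /= [s0 Cd] <-].
  have := sN.1 (x + s *: d) (- x); rewrite addrAC subrr add0r.
  suff : s <= N (s *: d) by lra.
  move: s0; rewrite le_eqVlt => /predU1P[<-|s0].
    by rewrite scale0r sublinear0.
  by rewrite sublinearZ// ler_pMr// NC.
have pge x m : (forall t c, 0 <= t -> C c -> m <= N (x + t *: c) - t) -> m <= p x.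
  move=> h; apply: lb_le_inf; last by move=> _ [[s d] /= [s0 Cd] <-]; exact: h.
  by exists (N (x + 0 *: c0) - 0), (0, c0).
have sp : sublinear p.
  split=> [x y|a x a0].
    rewrite -lerBlDr; apply: (pge) => s c s0 Cc; rewrite lerBlDr -lerBlDl.
    apply: (pge) => t d t0 Cd; rewrite lerBlDl.
    (* [e] is the convex combination of [c] and [d] with weights proportional to [s] and [t]; if
       both vanish, any point of [C] does. *)
    have [e Ce cde] : exists2 e, C e & s *: c + t *: d = (s + t) *: e.
      have := addr_ge0 s0 t0; rewrite le_eqVlt => /predU1P[st|st].
        have [-> ->] : s = 0 /\ t = 0 by lra.
        by exists c0 => //; rewrite addr0 !scale0r addr0.
      exists ((s / (s + t)) *: c + (t / (s + t)) *: d).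
        apply: cC => //; rewrite ?divr_ge0// ?ltW// -mulrDl divff//.
        by rewrite lt0r_neq0.
      by rewrite scalerDr !scalerA ![(s + t) * _]mulrC !divfK// lt0r_neq0.
    apply: le_trans (ple _ _ _ (addr_ge0 s0 t0) Ce) _.
    rewrite -cde addrACA.
    by have := sN.1 (x + s *: c) (y + t *: d); lra.
  rewrite -ler_pdivrMl//; apply: (pge) => t c t0 Cc; rewrite ler_pdivrMl//.
  apply: le_trans (ple _ _ _ (mulr_ge0 (ltW a0) t0) Cc) _.
  by rewrite -scalerA -scalerDr sublinearZ// mulrBr.
have [f [lf fp]] := sublinear_ge_linear sp; exists f; split=> //.
  move=> x; apply: le_trans (fp x) _.
  by have := ple x _ _ (lexx 0) Cc0; rewrite scale0r addr0 subr0.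
(* Taking [t = 1] in the bound at [- c] yields [N 0 - 1 = - 1]. *)
move=> c Cc; have := le_trans (fp (- c)) (ple (- c) _ _ ler01 Cc).
by rewrite (linear_funN lf) scale1r addNr sublinear0// sub0r lerN2.
Qed.

Definition convex_cone (P : set V) :=
  [/\ P 0, forall x y, P x -> P y -> P (x + y) &
      forall a x, 0 < a -> P x -> P (a *: x)].

(** Separate the convex set [v - P] from the origin. Since [P] is stable under large multiples, a
    positive value of [f] on [P] would break the lower bound [1] on [v - P]. *)
Lemma separate_convex_cone (N : V -> R) (P : set V) v : sublinear N ->
  convex_cone P -> (forall c, P c -> 1 <= N (v - c)) ->
  exists f : V -> R^o, [/\ linear f, forall x, f x <= N x,
    forall c, P c -> f c <= 0 & 1 <= f v].
Proof.
move=> sN [P0 PD PZ] vP; pose C := [set v - c | c in P].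
have PZ0 a x : 0 <= a -> P x -> P (a *: x).
  by rewrite le_eqVlt => /predU1P[<-|]; [rewrite scale0r|exact: PZ].
have cC : convex_set C.
  apply/convex_setP => _ _ s t s0 t0 st [c Pc <-] [d Pd <-].
  exists (s *: c + t *: d); first by apply: PD; exact: PZ0.
  by rewrite !scalerBr addrACA -scalerDl st scale1r opprD.
have C1 c : C c -> 1 <= N c by move=> [d Pd <-]; exact: vP.
have [|f [lf fN fC]] := separate_convex sN cC _ C1.
  by exists (v - 0), 0.
have fB x c a : f (x - a *: c) = f x - a * f c.
  by rewrite addrC -scaleNr lf /GRing.scale /= mulNr addrC.
have fPv c : P c -> f c <= f v - 1.
  move=> Pc; have : 1 <= f (v - 1 *: c) by rewrite scale1r; apply: fC; exists c.
  by rewrite fB mul1r lerBrDl -lerBrDr.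
exists f; split=> //.
  move=> c Pc; rewrite leNgt; apply/negP => fc0.
  (* Then [a * f c = |f v| + f c], so [f (v - a *: c)] is negative. *)
  pose a : R := `|f v| / f c + 1.
  have a0 : 0 < a by rewrite ltr_wpDl// divr_ge0// ltW.
  have : 1 <= f (v - a *: c) by apply: fC; exists (a *: c) => //; exact: PZ.
  rewrite fB /a mulrDl mul1r divfK ?gt_eqF//.
  by have := ler_norm (f v); lra.
have := fC (v - 0 *: v); rewrite fB mul0r subr0; apply.
by exists 0 => //; rewrite scale0r.
Qed.

End HahnBanach.

(** * Duality and the weak-star topology *)

Section Pairing.
Context {R : realType} {X : normedModType R}.
Implicit Types (x y : X) (f g : dual X).

Lemma dual_linear f : linear (dual_fun f).
Proof. by have /asboolP[] := dual_funP f. Qed.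

Lemma dual_continuous f : continuous (dual_fun f).
Proof. by have /asboolP[] := dual_funP f. Qed.

HB.instance Definition _ f :=
  GRing.isLinear.Build R X R^o _ (dual_fun f) (dual_linear f).

Lemma pairingDl x y f : <[x + y, f]> = <[x, f]> + <[y, f]>.
Proof. exact: linearD. Qed.

Lemma pairingBl x y f : <[x - y, f]> = <[x, f]> - <[y, f]>.
Proof. exact: linearB. Qed.

Lemma pairingNl x f : <[- x, f]> = - <[x, f]>.
Proof. exact: linearN. Qed.

Lemma pairingZl a x f : <[a *: x, f]> = a * <[x, f]>.
Proof. exact: linearZ. Qed.

Lemma pairing0l f : <[0, f]> = 0.
Proof. exact: linear0. Qed.

Lemma pairingDr x f g : <[x, f + g]> = <[x, f]> + <[x, g]>.
Proof. by []. Qed.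

Lemma pairingBr x f g : <[x, f - g]> = <[x, f]> - <[x, g]>.
Proof. by []. Qed.

Lemma pairingZr a x f : <[x, a *: f]> = a * <[x, f]>.
Proof. by []. Qed.

Lemma pairing0r x : <[x, 0]> = 0.
Proof. by []. Qed.

Lemma dual_of_bounded (h : X -> R^o) (M : R) : linear h ->
  (forall x, `|h x| <= M * `|x|) -> exists f, forall x, <[x, f]> = h x.
Proof.
move=> lh hM.
pose hl : {linear X -> R^o} := HB.pack h (GRing.isLinear.Build _ _ _ _ h lh).
have ch : continuous hl.
  apply/bounded_linear_continuous/linear_boundedP.
  near=> C; move=> x; apply: le_trans (hM x) _.
  by rewrite ler_wpM2r.
have hP : h \in @is_dual R X by apply/asboolP.
by exists (Dual hP).
Unshelve. all: by end_near. Qed.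

Lemma pairing_bounded f : exists2 M, 0 < M & forall x, `|<[x, f]>| <= M * `|x|.
Proof.
have /linear_bounded_continuous/linear_boundedP [M [Mr hM]] := @dual_continuous f.
exists (`|M| + 1); first by rewrite ltr_wpDl.
by apply: hM; rewrite (le_lt_trans (ler_norm M))// ltrDl.
Qed.

Lemma pairing_dual_norm x f : `|<[x, f]>| <= dual_norm f * `|x|.
Proof.
have [->|x0] := eqVneq x 0; first by rewrite pairing0l !normr0 mulr0.
have nx : 0 < `|x| by rewrite normr_gt0.
rewrite -ler_pdivrMr//; apply: ub_le_sup.
  have [M M0 hM] := pairing_bounded f; exists M => _ [y /= y1 <-].
  by apply: le_trans (hM y) _; rewrite ler_piMr// ltW.
exists (`|x|^-1 *: x) => /=.
  by rewrite normrZ normfV normr_id mulVf// normr_eq0.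
by rewrite pairingZl normrM normfV normr_id mulrC.
Qed.

Lemma dual_norm_ge0 f : 0 <= dual_norm f.
Proof.
have [M M0 hM] := pairing_bounded f.
apply: le_trans (normr_ge0 <[0, f]>) _; apply: ub_le_sup.
  exists M => _ [y /= y1 <-]; apply: le_trans (hM y) _.
  by rewrite ler_piMr// ltW.
by exists 0 => //=; rewrite normr0.
Qed.

Lemma dual_norm_le M f : 0 <= M -> (forall x, `|<[x, f]>| <= M * `|x|) ->
  dual_norm f <= M.
Proof.
move=> M0 h; apply: ge_sup; first by exists `|<[0, f]>|, 0 => //=; rewrite normr0.
by move=> _ [x /= x1 <-]; apply: le_trans (h x) _; rewrite ler_piMr.
Qed.

(** Weak-star open sets are preimages of open sets of the pointwise topology, so convergence can be
    tested at each vector. *)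
Lemma weak_star_cvgP (F : set_system (dual X)) (f : dual X) : Filter F ->
  (F --> (f : weak_star X)) <-> forall x, <[x, g]> @[g --> F] --> <[x, f]>.
Proof.
move=> FF; split=> [Ff x|h].
  have c1 : (@dual_fun R X : weak_star X -> {ptws X -> R^o}) @ F -->
      (dual_fun f : {ptws X -> R^o}).
    exact: (cvg_comp _ _ Ff (@initial_continuous _ _ _ _)).
  by have /pointwise_cvgP/(_ x) := c1.
move=> A [_ [[B oB <-] Bf BA]].
have c1 : (@dual_fun R X : dual X -> {ptws X -> R^o}) @ F -->
    (dual_fun f : {ptws X -> R^o}).
  by apply/pointwise_cvgP.
apply: (filterS BA); apply: (c1 B).
exact: open_nbhs_nbhs.
Qed.

End Pairing.

Section WeakStar.
Context {R : realType} {X : normedModType R}.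
Implicit Types (x y v : X) (f g : dual X) (C : set (dual X)).

(** Otherwise the traces on [C] of the basic neighbourhoods of [f] generate a proper filter that
    converges to [f], and closedness puts [f] in [C]. *)
Lemma weak_star_nbhs_disjoint C f :
  closed (C : set (weak_star X)) -> ~ C f ->
  exists (s : seq X) (e : R), 0 < e /\
    forall g, C g -> exists2 w, w \in s & e <= `|<[w, g - f]>|.
Proof.
move=> Ccl Cf; apply/not_existsP => H.
pose D := [set z : seq X * R | 0 < z.2].
pose B (z : seq X * R) := [set g | C g /\ forall w, w \in z.1 -> `|<[w, g - f]>| < z.2].
have FB : ProperFilter (filter_from D B).
  apply: filter_from_proper.
    apply: filter_from_filter; first by exists ([::], 1); rewrite /D /=.
    move=> [s e] [t d] /= e0 d0; exists (s ++ t, Num.min e d).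
      by rewrite /D /= lt_min e0.
    move=> g /= [Cg h]; split; split=> // w ws;
      have := h w; rewrite mem_cat ws ?orbT lt_min => /(_ isT)/andP[]//.
  move=> [s e] /= e0; apply/set0P/eqP => B0.
  apply: (H s); exists e; split=> // g Cg; apply/not_exists2P => hw.
  have : B (s, e) g.
    by split=> // w ws; rewrite ltNge; apply/negP => ?; case: (hw w).
  by rewrite B0.
have Ff : filter_from D B --> (f : weak_star X).
  apply/weak_star_cvgP => x; apply/cvgrPdist_lt => e e0.
  exists ([:: x], e) => //= g [_ /(_ x)]; rewrite inE eqxx => /(_ isT).
  by rewrite pairingBr distrC.
apply: Cf; apply: Ccl => A fA.
have FC : filter_from D B C by exists ([::], 1) => [|g []//]; rewrite /D /=.
exact: filter_ex (filterI FC (Ff A fA)).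
Qed.

(** Evaluation at the finitely many vectors that keep [C] away from [f] maps [C] to a convex set of
    row vectors of sum norm at least [e]. A functional on row vectors is a combination of
    coordinates, so the separating functional is evaluation at a vector of [X]. *)
Lemma weak_star_separation C f :
  closed (C : set (weak_star X)) -> convex_set C -> C !=set0 -> ~ C f ->
  exists v, forall g, C g -> <[v, g]> + 1 <= <[v, f]>.
Proof.
move=> Ccl /convex_setP cC [g0 Cg0] Cf.
have [s [e [e0 he]]] := weak_star_nbhs_disjoint Ccl Cf.
pose n := size s; pose w (i : 'I_n) := tnth (in_tuple s) i.
pose ev (g : dual X) : 'rV[R]_n := \row_i <[w i, g - f]>.
pose N (q : 'rV[R]_n) : R := e^-1 * \sum_i `|q 0 i|.
have sN : sublinear N.
  split=> [p q|a q a0]; rewrite /N.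
    rewrite -mulrDr ler_pM2l ?invr_gt0// -big_split /=.
    by apply: ler_sum => i _; rewrite mxE ler_normD.
  rewrite mulrCA ler_pM2l ?invr_gt0// mulr_sumr.
  by apply: ler_sum => i _; rewrite mxE normrM gtr0_norm.
have cev : convex_set [set ev g | g in C].
  apply/convex_setP => _ _ a b a0 b0 ab [g Cg <-] [h Ch <-].
  exists (a *: g + b *: h); first exact: cC.
  apply/rowP => i; rewrite !mxE !pairingBr pairingDr !pairingZr.
  have -> : b = 1 - a by lra.
  rewrite /GRing.scale /=; ring.
have [||h [lh hN hC]] := separate_convex sN cev.
- by exists (ev g0), g0.
- move=> _ [g Cg <-]; have [u us eu] := he _ Cg.
  rewrite ler_pdivlMl// mulr1; apply: le_trans eu _.
  have [i ->] : exists i, u = w i.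
    by have /tnthP[i ->] : u \in in_tuple s by []; exists i.
  rewrite (bigD1 i)//= mxE lerDl; exact: sumr_ge0.
pose lh' : {linear 'rV[R]_n -> R^o} := HB.pack h (GRing.isLinear.Build _ _ _ _ h lh).
(* The sign is reversed because [h] is at least [1] on the images of [g - f]. *)
exists (- \sum_i h (delta_mx 0 i) *: w i) => g Cg.
have : 1 <= lh' (ev g) by apply: hC; exists g.
rewrite (row_sum_delta (ev g)) linear_sum /=.
have -> : \sum_i lh' (ev g 0 i *: delta_mx 0 i) =
    <[\sum_i h (delta_mx 0 i) *: w i, g - f]>.
  rewrite /pairing linear_sum; apply: eq_bigr => i _; rewrite !linearZ /=.
  by rewrite mxE /pairing /GRing.scale /= mulrC.
by rewrite pairingBr !pairingNl; lra.
Qed.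

(** The Banach-Alaoglu theorem for ultrafilters: at each [x] the values stay in a compact segment,
    hence converge along [U], and linearity and the bound pass to the limits. *)
Lemma bounded_ultrafilter_cvg (I : Type) (U : set_system I) (F : I -> dual X)
    (M : R) : UltraFilter U -> (forall i x, `|<[x, F i]>| <= M * `|x|) ->
  exists f, forall x, <[x, F i]> @[i --> U] --> <[x, f]>.
Proof.
move=> UU FM.
have lim x : {l : R | <[x, F i]> @[i --> U] --> l}.
  apply: cid; have [|l [_ hl]] := @segment_compact R (- (M * `|x|)) (M * `|x|)
      (<[x, F i]> @[i --> U]) _.
    apply: (@filterS _ U _ setT) => [i _ /=|]; last exact: filterT.
    by have := FM i x; rewrite ler_norml in_itv.
  (* A cluster point of an ultrafilter is a limit: the complement of a neighbourhood cannot be in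
     the ultrafilter. *)
  exists l => A lA; have [//|UA] := in_ultra_setVsetC (fun i => A <[x, F i]>) UU.
  by have [y []] := hl (~` A) A UA lA.
pose h x : R^o := sval (lim x).
have lh : linear h.
  move=> a x y.
  have hxy : <[a *: x + y, F i]> @[i --> U] --> a * h x + h y.
    rewrite (_ : (fun i => _) = (fun i => a * <[x, F i]> + <[y, F i]>)).
      apply: cvgD; last exact: (svalP (lim y)).
      by apply: cvgMr; exact: (svalP (lim x)).
    by apply/funext => i; rewrite pairingDl pairingZl.
  exact: (cvg_unique (@norm_hausdorff _ R^o) (svalP (lim _)) hxy).
have hM x : `|h x| <= M * `|x|.
  apply: cvgr_to_le (cvg_norm (svalP (lim x))) _.
  by near=> i; exact: FM.
have [f hf] := dual_of_bounded lh hM.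
by exists f => x; rewrite hf; exact: (svalP (lim x)).
Unshelve. all: by end_near. Qed.

(* The net extracted from a filter [U] on [I] is indexed by the pairs
   [(A, i)] with [U A] and [A i]. *)
Lemma demiclosed_filter (T : X -> set (dual X)) (S : set X) (I : Type)
    (U : set_system I) (x_ : I -> X) (F : I -> dual X) (M : R) x f :
  ProperFilter U -> demiclosed T S -> (forall i, T (x_ i) (F i)) ->
  x_ @ U --> x -> (forall y, <[y, F i]> @[i --> U] --> <[y, f]>) ->
  0 <= M -> (forall i y, `|<[y, F i]>| <= M * `|y|) -> S x -> T x f.
Proof.
move=> UF dT TF xU FU M0 FM Sx.
pose J := {p : set I * I | U p.1 /\ p.1 p.2}.
pose le (p q : J) := (sval q).1 `<=` (sval p).1.
pose idx (p : J) := (sval p).2.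
have idxU : idx @ tails le --> U.
  move=> A UA; have [a Aa] := filter_ex UA.
  exists (exist _ (A, a) (conj UA Aa)) => -[[B b] /= [UB Bb]] BA.
  exact: BA.
have Uex A : U A -> exists a, U A /\ A a.
  by move=> UA; have [a Aa] := filter_ex UA; exists a.
apply: (dT J le (x_ \o idx) (F \o idx)) => //.
- split=> [|p|p q r|p q] //.
  + have [a h] := Uex _ filterT.
    exact: (inhabits (exist _ (setT, a) h)).
  + by rewrite /le => pq qr; exact: subset_trans qr pq.
  + have [a h] := Uex _ (filterI (svalP p).1 (svalP q).1).
    exists (exist _ ((sval p).1 `&` (sval q).1, a) h).
    by split => i [].
- by move=> p; exact: TF.
- exact: (cvg_comp _ _ idxU xU).
- have ft : Filter (tails le).
    have [a h] := Uex _ filterT.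
    split=> [|P Q [p hp] [q hq]|P Q PQ [p hp]].
    + by exists (exist _ (setT, a) h).
    + have [b hb] := Uex _ (filterI (svalP p).1 (svalP q).1).
      exists (exist _ ((sval p).1 `&` (sval q).1, b) hb) => r hr.
      by split; [apply: hp|apply: hq] => i /hr [].
    + by exists p => r /hp /PQ.
  apply/weak_star_cvgP => y.
  exact: (cvg_comp _ _ idxU (FU y)).
- by exists M => p; apply: dual_norm_le => // y; exact: FM.
Qed.

End WeakStar.

(** * Closed subspaces and uniform boundedness *)

Section LinearSubspace.
Context {R : realType} {X : normedModType R}.
Implicit Types (x y v : X) (f g : dual X) (Y : set X).

Definition linear_subspace Y :=
  Y 0 /\ forall a u v, Y u -> Y v -> Y (a *: u + v).

Lemma linear_subspaceZ Y a u : linear_subspace Y -> Y u -> Y (a *: u).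
Proof. by move=> [Y0 Yl] Yu; rewrite -[a *: u]addr0; exact: Yl. Qed.

Lemma linear_subspaceD Y u v : linear_subspace Y -> Y u -> Y v -> Y (u + v).
Proof. by move=> [Y0 Yl] Yu; rewrite -[u in u + v]scale1r; exact: Yl. Qed.

Lemma linear_subspaceN Y u : linear_subspace Y -> Y u -> Y (- u).
Proof. by move=> sY; rewrite -scaleN1r; exact: linear_subspaceZ. Qed.

Lemma linear_subspaceB Y u v : linear_subspace Y -> Y u -> Y v -> Y (u - v).
Proof. by move=> sY Yu /(linear_subspaceN sY); exact: linear_subspaceD. Qed.

(** A ball of radius [e] around [v] misses [P], so the norm divided by [e] is at least [1] on
    [v - P]; a functional below this multiple of the norm is continuous. *)
Lemma separate_closed_cone (P : set X) v :
  closed P -> convex_cone P -> ~ P v ->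
  exists f, (forall c, P c -> <[c, f]> <= 0) /\ 0 < <[v, f]>.
Proof.
move=> clP cP Pv.
have /nbhs_ballP[e /= e0 ve] : nbhs v (~` P).
  by apply: open_nbhs_nbhs; split=> //; exact: closed_openC.
pose N x : R := e^-1 * `|x|.
have sN : sublinear N.
  split=> [x y|a x a0]; rewrite /N.
    by rewrite -mulrDr ler_pM2l ?invr_gt0// ler_normD.
  by rewrite normrZ gtr0_norm// mulrCA.
have [|f [lf fN fP fv]] := separate_convex_cone sN cP (v := v).
  move=> c Pc; rewrite ler_pdivlMl// mulr1 leNgt; apply/negP => vc.
  by apply: (ve c) => //; rewrite -ball_normE.
have [|g hg] := @dual_of_bounded _ _ f e^-1 lf.
  move=> x; rewrite ler_norml fN andbT lerNl.
  by rewrite -(linear_funN lf) -[`|x|]normrN; exact: fN.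
exists g; split=> [c Pc|]; first by rewrite hg; exact: fP.
by rewrite hg (lt_le_trans ltr01).
Qed.

(** Hahn-Banach extension with the same bound. Separate [v], where [f] is [1], from the kernel of
    [f] in [Y]: the functional obtained vanishes on this kernel and is at least [1] at [v], so
    dividing by its value at [v] gives the extension without raising the bound. *)
Lemma dual_extension Y f (M : R) : linear_subspace Y -> 0 < M ->
  (forall y, Y y -> `|<[y, f]>| <= M * `|y|) ->
  exists g, (forall y, Y y -> <[y, g]> = <[y, f]>) /\
    forall x, `|<[x, g]>| <= M * `|x|.
Proof.
move=> sY M0 fM.
have [f0|/existsNP[u /not_implyP[Yu fu]]] :=
  pselect (forall y, Y y -> <[y, f]> = 0).
  exists 0; split=> [y /f0 ->//|x]; rewrite pairing0r normr0.
  by rewrite mulr_ge0// ltW.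
pose v := <[u, f]>^-1 *: u.
have Yv : Y v by exact: linear_subspaceZ.
have fv : <[v, f]> = 1 by rewrite pairingZl mulVf//; exact/eqP.
pose N x : R := M * `|x|.
have sN : sublinear N.
  split=> [x y|a x a0]; rewrite /N.
    by rewrite -mulrDr ler_pM2l// ler_normD.
  by rewrite normrZ gtr0_norm// mulrCA.
pose P := [set y | Y y /\ <[y, f]> = 0].
have cP : convex_cone P.
  split=> [|x y [Yx fx] [Yy fy]|a x a0 [Yx fx]].
  - by split; [exact: sY.1|rewrite pairing0l].
  - by split; [exact: linear_subspaceD|rewrite pairingDl fx fy addr0].
  - by split; [exact: linear_subspaceZ|rewrite pairingZl fx mulr0].
have [|h [lh hN hP hv]] := separate_convex_cone sN cP (v := v).
  move=> c [Yc fc]; have := fM _ (linear_subspaceB sY Yv Yc).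
  by rewrite pairingBl fc fv subr0 normr1.
have hM x : `|h x| <= M * `|x|.
  rewrite ler_norml hN andbT lerNl.
  by rewrite -(linear_funN lh) -[`|x|]normrN; exact: hN.
have [g hg] := dual_of_bounded lh hM.
pose g' := <[v, g]>^-1 *: g.
have gv1 : 1 <= <[v, g]> by rewrite hg.
have gv0 : 0 < <[v, g]> by rewrite (lt_le_trans ltr01).
exists g'; split=> [y Yy|x].
  have Pw : P (y - <[y, f]> *: v).
    split; first by apply: linear_subspaceB => //; exact: linear_subspaceZ.
    by rewrite pairingBl pairingZl fv mulr1 subrr.
  have PN : P (- (y - <[y, f]> *: v)).
    split; first exact: linear_subspaceN sY Pw.1.
    by rewrite pairingNl Pw.2 oppr0.
  have := hP _ Pw; have := hP _ PN.
  rewrite (linear_funN lh) -hg pairingBl pairingZl pairingZr => h1 h2.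
  have -> : <[y, g]> = <[y, f]> * <[v, g]> by lra.
  by rewrite mulrC mulfK// gt_eqF.
rewrite pairingZr normrM gtr0_norm ?invr_gt0// ler_pdivrMl//.
rewrite hg; apply: le_trans (hM x) _.
by rewrite ler_peMl// mulr_ge0// ltW.
Qed.

End LinearSubspace.

Section BanachSteinhaus.
Context {R : realType} {X : completeNormedModType R}.
Variables (Y : set X) (F : set (dual X)).
Hypotheses (sY : linear_subspace Y) (clY : closed Y).

Let unbounded := forall M : R, 0 < M ->
  exists f w, [/\ F f, Y w & M * `|w| < `|<[w, f]>|].

(** Of [x + u] and [x - u] one has a large value under [f], because their values differ by twice
    that of [u]. The radius is at most [C^-1], so that [f] varies by at most [1] on the new ball. *)
Let refine (x : X) (r : R) (n : nat) : unbounded -> Y x -> 0 < r ->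
  exists x' r', [/\ Y x', 0 < r', `|x' - x| + r' <= r, r' <= r / 2 &
    exists2 f, F f & forall z, `|z - x'| <= r' -> n%:R < `|<[z, f]>|].
Proof.
move=> ub Yx r0.
(* With this factor the multiple of [w] of norm [r / 2] has a value above [n + 1]. *)
have M0 : 0 < 2 * (n%:R + 1) / r :> R by rewrite !mulr_gt0 ?invr_gt0// ltr_wpDl.
have [f [w [Ff Yw fw]]] := ub _ M0.
have w0 : 0 < `|w|.
  by rewrite normr_gt0; apply/eqP => w0; move: fw; rewrite w0 pairing0l !normr0; lra.
pose u := (r / 2 / `|w|) *: w.
have Yu : Y u by exact: linear_subspaceZ.
have nu : `|u| = r / 2.
  by rewrite normrZ gtr0_norm ?divr_gt0// divfK// gt_eqF.
have fu : n%:R + 1 < `|<[u, f]>|.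
  rewrite pairingZl normrM gtr0_norm ?divr_gt0//.
  have <- : r / 2 / `|w| * (2 * (n%:R + 1) / r * `|w|) = n%:R + 1.
    by field; rewrite !gt_eqF.
  by rewrite ltr_pM2l// !divr_gt0.
have [x' [Yx' x'x fx']] :
    exists x', [/\ Y x', `|x' - x| <= r / 2 & n%:R + 1 < `|<[x', f]>|].
  have [h|h] := ltP (n%:R + 1) `|<[x + u, f]>|.
    exists (x + u); split=> //; first exact: linear_subspaceD.
    by rewrite addrAC subrr add0r nu.
  exists (x - u); split=> //; first exact: linear_subspaceB.
    by rewrite addrAC subrr add0r normrN nu.
  have := ler_normB <[x + u, f]> <[x - u, f]>.
  have -> : <[x + u, f]> - <[x - u, f]> = 2 * <[u, f]>.
    by rewrite pairingDl pairingBl; ring.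
  by rewrite normrM ger0_norm//; lra.
have [C C0 fC] := pairing_bounded f.
have r20 : 0 < r / 2 by rewrite divr_gt0.
exists x', (Num.min (r / 2) C^-1); split=> //.
- by rewrite lt_min r20 invr_gt0.
- have : Num.min (r / 2) C^-1 <= r / 2 by rewrite ge_min lexx.
  by lra.
- by rewrite ge_min lexx.
exists f => // z; rewrite le_min => /andP[_ zx'].
have : `|<[z - x', f]>| <= 1.
  by apply: le_trans (fC _) _; rewrite -ler_pdivlMl// mulr1.
have := ler_normB <[z, f]> <[z - x', f]>.
rewrite [in X in X <= _ -> _]pairingBl opprB addrCA subrr addr0; lra.
Qed.

(* Baire's argument: were [F] not uniformly bounded on [Y], nested balls would
   close in on a point where it is not pointwise bounded. *)
Lemma banach_steinhaus_subspace :
  (forall w, Y w -> exists B : R, forall f, F f -> <[w, f]> <= B) ->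
  exists2 M : R, 0 < M & forall f w, F f -> Y w -> `|<[w, f]>| <= M * `|w|.
Proof.
move=> pb; apply: contrapT => nb.
have ub : unbounded.
  move=> M M0; apply: contrapT => H; apply: nb; exists M => // f w Ff Yw.
  by rewrite leNgt; apply/negP => ?; apply: H; exists f, w.
pose good (z : X * R) := Y z.1 /\ 0 < z.2.
have step (n : nat) (z : {z | good z}) : {z' : {z | good z} |
    [/\ `|(sval z').1 - (sval z).1| + (sval z').2 <= (sval z).2,
        (sval z').2 <= (sval z).2 / 2 &
    exists2 f, F f & forall t, `|t - (sval z').1| <= (sval z').2 -> n%:R < `|<[t, f]>|]}.
  apply: cid; case: z => -[x r] /= [Yx r0].
  have [x' [r' [Yx' r'0 h1 h2 h3]]] := refine n ub Yx r0.
  by exists (exist _ (x', r') (conj Yx' r'0)).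
have good0 : good (0, 1) by split => //; exact: sY.1.
pose z := fix z n := if n is m.+1 then sval (step m (z m)) else exist _ _ good0.
pose x n := (sval (z n)).1; pose r n := (sval (z n)).2.
have Yx n : Y (x n) := (svalP (z n)).1.
have r0 n : 0 < r n := (svalP (z n)).2.
have nest n : [/\ `|x n.+1 - x n| + r n.+1 <= r n, r n.+1 <= r n / 2 &
    exists2 f, F f & forall t, `|t - x n.+1| <= r n.+1 -> n%:R < `|<[t, f]>|].
  exact: svalP (step n (z n)).
have xr n m : `|x (n + m)%N - x n| + r (n + m)%N <= r n.
  elim: m => [|m IH]; first by rewrite addn0 subrr normr0 add0r.
  rewrite addnS; have [h _ _] := nest (n + m)%N.
  have := ler_normD (x (n + m).+1 - x (n + m)%N) (x (n + m)%N - x n).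
  by rewrite addrA subrK; lra.
have r2 n : r n <= 2^-1 ^+ n.
  elim: n => [|n IH]; first by rewrite expr0.
  by have [_ h _] := nest n; rewrite exprS; lra.
have cx : cvg (x @ \oo).
  apply: cauchy_cvg; apply: cauchy_exP => e e0.
  have [n rn] : exists n, r n < e.
    have /cvgrPdist_lt/(_ e e0)[n _ /(_ n (leqnn n))] :=
      @cvg_expr R 2^-1 (ltac:(rewrite ger0_norm; lra)).
    rewrite sub0r normrN ger0_norm ?exprn_ge0// => h.
    by exists n; exact: le_lt_trans (r2 n) h.
  exists (x n), n => // m /= nm; rewrite -ball_normE /= distrC.
  have := xr n (m - n)%N; rewrite subnKC//.
  by have := r0 m; lra.
pose l := lim (x @ \oo).
have Yl : Y l by apply: closed_cvg cx => //; exact: nearW.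
have lx n : `|l - x n| <= r n.
  have h : (fun m => `|x m - x n|) @ \oo --> `|l - x n|.
    by apply: cvg_norm; apply: cvgB => //; exact: cvg_cst.
  apply: cvgr_to_le h _; exists n => // m /= nm.
  by have := xr n (m - n)%N; rewrite subnKC//; have := r0 m; lra.
have [B hB] := pb l Yl; have [B' hB'] := pb (- l) (linear_subspaceN sY Yl).
(* [l] lies in every ball, while in ball [n.+1] some member of [F] exceeds [n], hence exceeds its
   bounds at [l] and [- l]. *)
pose n := Num.bound `|Num.max B B'|.
have [_ _ [f Ff /(_ l (lx _))]] := nest n.
have : Num.max B B' < n%:R by rewrite (le_lt_trans (ler_norm _))// archi_boundP.
rewrite gt_max => /andP[Bn B'n]; apply/negP; rewrite -leNgt.
have := hB f Ff; have := hB' f Ff; rewrite pairingNl ler_norml; lra.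
Qed.

End BanachSteinhaus.

(** * Relative interiors and tangent cones of nearly convex sets *)

Section AffineGeometry.
Context {R : realType} {X : normedModType R}.
Implicit Types (x y u v w : X) (S A : set X) (a b t r e : R).

Lemma closure_normP S x :
  closure S x <-> forall e, 0 < e -> exists2 y, S y & `|x - y| < e.
Proof.
split=> [Sx e e0|h B /nbhs_ballP[e /= e0 xB]].
  have [y [Sy]] := Sx _ (nbhsx_ballx x e e0).
  by rewrite -ball_normE /= => ?; exists y.
have [y Sy xy] := h e e0; exists y; split=> //.
by apply: xB; rewrite -ball_normE.
Qed.

(** Reduces vector identities to scalar ones, which [ring] and [field] can settle. *)
Lemma pairing_inj x y : (forall f, <[x, f]> = <[y, f]>) -> x = y.
Proof.
move=> xy; apply/eqP; rewrite -subr_eq0; apply/eqP; apply: contrapT => xy0.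
have cl0 : closed [set 0 : X].
  exact: (accessible_closed_set1 (hausdorff_accessible (@norm_hausdorff _ X))).
have [||f [_]] := @separate_closed_cone _ _ [set 0] (x - y) cl0.
- split=> //= [u v -> ->|a u _ ->]; [exact: addr0|exact: scaler0].
- by [].
by rewrite pairingBl xy subrr ltxx.
Qed.

Definition pairingE :=
  (@pairingDl R X, @pairingBl R X, @pairingNl R X, @pairingZl R X).

Lemma closure_lincomb S a b x y :
  (forall u v, S u -> S v -> S (a *: u + b *: v)) ->
  closure S x -> closure S y -> closure S (a *: x + b *: y).
Proof.
move=> Sab /closure_normP Sx /closure_normP Sy; apply/closure_normP => e e0.
have ab0 : 0 < `|a| + `|b| + 1 by rewrite ltr_wpDl// addr_ge0.
have d0 : 0 < e / (`|a| + `|b| + 1) by rewrite divr_gt0.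
have [x' Sx' xx'] := Sx _ d0; have [y' Sy' yy'] := Sy _ d0.
exists (a *: x' + b *: y'); first exact: Sab.
rewrite opprD addrACA -!scalerBr.
apply: le_lt_trans (ler_normD _ _) _; rewrite !normrZ.
have ha := ler_wpM2l (normr_ge0 a) (ltW xx').
have hb := ler_wpM2l (normr_ge0 b) (ltW yy').
apply: le_lt_trans (lerD ha hb) _.
by rewrite -mulrDl mulrA ltr_pdivrMr// mulrC ltr_pM2l// ltrDl.
Qed.

Lemma closure_affine A : affine_set A -> affine_set (closure A).
Proof.
by move=> aA x y t Ax Ay; apply: closure_lincomb => // u v Au Av; exact: aA.
Qed.

Lemma closure_convex A : convex_set A -> convex_set (closure A).
Proof.
move=> /convex_setP cA; apply/convex_setP => x y s t s0 t0 st Ax Ay.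
by apply: closure_lincomb => // u v Au Av; exact: cA.
Qed.

Lemma affine_affine_hull S : affine_set (affine_hull S).
Proof.
by move=> x y t Sx Sy B [aB SB]; have H := conj aB SB; apply: aB; [exact: Sx H|exact: Sy H].
Qed.

Lemma sub_affine_hull S : S `<=` affine_hull S.
Proof. by move=> x Sx B [_ SB]; exact: SB. Qed.

Lemma affine_hull_sub S A : affine_set A -> S `<=` A -> affine_hull S `<=` A.
Proof. by move=> aA SA x; apply. Qed.

Lemma closure_affine_hull_sub S A : affine_set A -> closed A -> S `<=` A ->
  closure (affine_hull S) `<=` A.
Proof.
move=> aA clA SA; rewrite closureE => x; apply; split=> //.
exact: affine_hull_sub.
Qed.

(** Unfolds the subspace topology into norm balls of the closed affine hull. *)
Lemma riP S x : ri S x <-> closure (affine_hull S) x /\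
  exists2 r, 0 < r & forall y, closure (affine_hull S) y -> `|y - x| < r -> S y.
Proof.
split=> [rS|[Ax [r r0 h]]].
  have Sx : S x := nbhs_singleton rS.
  have Ax : closure (affine_hull S) x by apply: subset_closure; exact: sub_affine_hull.
  have : within (closure (affine_hull S)) (nbhs x) S by rewrite nbhs_subspace_in.
  move=> /nbhs_ballP[r /= r0 h]; split=> //; exists r => // y Ay yx.
  by apply: h => //; rewrite -ball_normE /= distrC.
suff : within (closure (affine_hull S)) (nbhs x) S by rewrite nbhs_subspace_in.
apply/nbhs_ballP; exists r => //= y; rewrite -ball_normE /= distrC => yx Ay.
exact: h.
Qed.

(** For nonempty [S], the closed linear subspace parallel to the affine hull; translation invariance
    avoids choosing a base point. *)
Definition direction S := [set w | forall z,
  closure (affine_hull S) z -> closure (affine_hull S) (z + w)].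

Lemma directionB S x y : closure (affine_hull S) x -> closure (affine_hull S) y ->
  direction S (x - y).
Proof.
set A := closure _ => Ax Ay z Az; have aA : affine_set A.
  exact: (closure_affine (@affine_affine_hull S)).
(* The reflection of [y] in the midpoint of [z] and [x]. *)
have -> : z + (x - y) = (1 - 2) *: y + 2 *: ((1 - 2^-1) *: z + 2^-1 *: x).
  by apply: pairing_inj => f; rewrite !pairingE; field.
by apply: (aA) => //; exact: aA.
Qed.

Lemma direction_subspace S : S !=set0 -> linear_subspace (direction S).
Proof.
move=> [x Sx]; have Ax : closure (affine_hull S) x.
  by apply: subset_closure; exact: sub_affine_hull.
have aA := closure_affine (@affine_affine_hull S).
split=> [z Az|a u v Yu Yv]; first by rewrite addr0.
have -> : a *: u + v = ((1 - a) *: x + a *: (x + u)) + v - x.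
  by apply: pairing_inj => f; rewrite !pairingE; ring.
by apply: directionB => //; apply: Yv; apply: aA => //; exact: Yu.
Qed.

Lemma closed_direction S : closed (direction S).
Proof.
move=> w /closure_normP h z Az.
have : closure (closure (affine_hull S)) (z + w); last first.
  by rewrite -(closure_id _).1//; exact: closed_closure.
apply/closure_normP => e e0; have [y Yy wy] := h e e0.
exists (z + y); first exact: Yy.
by rewrite opprD addrACA subrr add0r.
Qed.

End AffineGeometry.

Section NearlyConvex.
Context {R : realType} {X : normedModType R}.
Implicit Types (x y u v w : X) (D S : set X) (r t e : R).

Variable D : set X.
Hypothesis ncD : nearly_convex D.

Local Notation K := (closure D).
Local Notation A := (closure (affine_hull D)).
Local Notation Y := (direction D).

Lemma closure_sub_affine_hull S : closure S `<=` closure (affine_hull S).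
Proof. exact: closure_subset (@sub_affine_hull _ _ S). Qed.

Lemma closure_sub_closed S S' : closed S' -> S `<=` S' -> closure S `<=` S'.
Proof. by move=> clS' SS'; rewrite closureE => x; apply. Qed.

Lemma direction_closureB S x y : closure S x -> closure S y -> direction S (x - y).
Proof.
by move=> /closure_sub_affine_hull Sx /closure_sub_affine_hull; exact: directionB.
Qed.

(** The convex set [C] that witnesses near convexity has the closure and the closed affine hull of
    [D], so its relative balls can be written with the direction of [D]. *)
Lemma nearly_convex_core : exists C,
  [/\ convex_set C, C `<=` D, closure C = K &
   exists x0, exists2 r, 0 < r & forall w, Y w -> `|w| < r -> C (x0 + w)].
Proof.
have [C [cC [x0 /riP[Ax0 [r r0 hr]]] CD DC]] := ncD.
have CK : closure C = K.
  apply/seteqP; split; first exact: closure_subset.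
  by apply: closure_sub_closed => //; exact: closed_closure.
have AE : closure (affine_hull C) = A.
  apply/seteqP; split; apply: closure_affine_hull_sub; try exact: closed_closure;
    try exact: (closure_affine (@affine_affine_hull _ _ _)).
  - by apply: subset_trans CD _; apply: subset_trans (@subset_closure _ _);
       exact: sub_affine_hull.
  - exact: subset_trans DC (@closure_sub_affine_hull C).
rewrite AE in Ax0 hr.
exists C; split=> //; exists x0, r => // w Yw wr; apply: hr; first exact: Yw.
by rewrite addrAC subrr add0r.
Qed.

Lemma nearly_convex_neq0 : D !=set0.
Proof.
have [C [_ CD _ [x0 [r r0 h]]]] := nearly_convex_core.
exists (x0 + 0); apply/CD/h; last by rewrite normr0.
by move=> z; rewrite addr0.
Qed.

Let sY : linear_subspace Y := direction_subspace nearly_convex_neq0.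

Let YZ a u : Y u -> Y (a *: u).
Proof. exact: linear_subspaceZ sY. Qed.

Let YD u v : Y u -> Y v -> Y (u + v).
Proof. exact: linear_subspaceD sY. Qed.

Let YB u v : Y u -> Y v -> Y (u - v).
Proof. exact: linear_subspaceB sY. Qed.

Lemma nearly_convex_closure : convex_set K.
Proof. by have [C [cC _ <- _]] := nearly_convex_core; exact: closure_convex. Qed.

Lemma nearly_convex_riP x : ri D x <->
  K x /\ exists2 r, 0 < r & forall w, Y w -> `|w| < r -> K (x + w).
Proof.
split=> [rx|[Kx [r r0 hr]]].
  have /riP[Ax [r r0 hr]] := rx; split.
    exact/subset_closure/(nbhs_singleton rx).
  exists r => // w Yw wr; apply/subset_closure/hr; first exact: Yw.
  by rewrite addrAC subrr add0r.
have [C [/convex_setP cC CD CK [x0 [r' r'0 hC]]]] := nearly_convex_core.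
have Kx0 : K x0.
  apply/subset_closure/CD; rewrite -[x0]addr0; apply: hC; first exact: sY.1.
  by rewrite normr0.
(* Prolong the segment from [x0] through [y] to a point [z] of [K] and approximate [z] by [c] in
   [C]. The error is absorbed by moving [x0] within its ball in [C], so that [y] becomes a convex
   combination of points of [C]. *)
have core y e : 0 < e -> K y -> (forall w, Y w -> `|w| < e -> K (y + w)) -> C y.
  move=> e0 Ky hy; pose d : R := e / (`|y - x0| + 1).
  have d0 : 0 < d by rewrite divr_gt0// ltr_wpDl.
  have Yyx : Y (y - x0) by exact: direction_closureB.
  have Kz : K (y + d *: (y - x0)).
    apply: hy; first exact: YZ.
    by rewrite normrZ gtr0_norm// mulrAC ltr_pdivrMr ?ltr_wpDl// ltr_pM2l// ltrDl.
  have dr' : 0 < d * r' by rewrite mulr_gt0.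
  have := Kz; rewrite -CK => /closure_normP /(_ _ dr')[c Cc zc].
  set z := y + _ in Kz zc.
  have Kc : K c by exact/subset_closure/CD.
  have -> : y = (1 + d)^-1 *: c + (d / (1 + d)) *: (x0 + d^-1 *: (z - c)).
    by apply: pairing_inj => f; rewrite !pairingE; field; rewrite !gt_eqF// addr_gt0.
  have d10 : 0 < 1 + d by rewrite addr_gt0.
  apply: cC => //.
  - by rewrite invr_ge0 ltW.
  - by rewrite divr_ge0// ltW.
  - by field; rewrite gt_eqF.
  - apply: hC; first by apply: YZ; exact: direction_closureB.
    by rewrite normrZ gtr0_norm ?invr_gt0// ltr_pdivrMl.
apply/riP; split; first exact: closure_sub_affine_hull.
exists (r / 2); first by rewrite divr_gt0.
move=> y Ay yx; have Yyx : Y (y - x).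
  by apply: directionB => //; exact: closure_sub_affine_hull.
have yE : y = x + (y - x) by rewrite addrCA subrr addr0.
apply: CD; apply: (core y (r / 2)); first by rewrite divr_gt0.
  by rewrite yE; apply: hr => //; lra.
move=> w Yw wr; rewrite yE -addrA; apply: hr; first exact: YD.
by apply: le_lt_trans (ler_normD _ _) _; lra.
Qed.

Lemma ri_sub : ri D `<=` D.
Proof. by move=> x rx; exact: (nbhs_singleton rx). Qed.

Lemma ri_neq0 : ri D !=set0.
Proof.
have [C [_ CD _ [x0 [r r0 h]]]] := nearly_convex_core.
have hK w : Y w -> `|w| < r -> K (x0 + w).
  by move=> Yw wr; exact/subset_closure/CD/h.
exists x0; apply/nearly_convex_riP; split; last by exists r.
by rewrite -[x0]addr0; apply: hK; [exact: sY.1|rewrite normr0].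
Qed.

(** The homothety with centre [x] and ratio [t] maps the ball of radius [r] around [y] to a ball of
    radius [t * r] inside [K]. *)
Lemma ri_segment x y t : K x -> ri D y -> 0 < t -> t <= 1 ->
  ri D (x + t *: (y - x)).
Proof.
move=> Kx /nearly_convex_riP[Ky [r r0 hr]] t0 t1.
have /convex_setP cK := nearly_convex_closure.
have mix z : K z -> K (x + t *: (z - x)).
  move=> Kz; rewrite (_ : _ + _ = (1 - t) *: x + t *: z).
    by apply: cK => //; lra.
  by apply: pairing_inj => f; rewrite !pairingE; ring.
apply/nearly_convex_riP; split; first exact: mix.
exists (t * r); first by rewrite mulr_gt0.
move=> w Yw wr; rewrite (_ : _ + w = x + t *: ((y + t^-1 *: w) - x)).
  apply/mix/hr; first exact: YZ.
  by rewrite normrZ gtr0_norm ?invr_gt0// ltr_pdivrMl.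
by apply: pairing_inj => f; rewrite !pairingE; field; rewrite gt_eqF.
Qed.

Lemma ri_direction x v : ri D x -> Y v -> exists2 s : R, 0 < s & ri D (x + s *: v).
Proof.
move=> /nearly_convex_riP[Kx [r r0 hr]] Yv.
have v1 : 0 < `|v| + 1 by rewrite ltr_wpDl.
exists (r / 2 / (`|v| + 1)); first by rewrite !divr_gt0.
have nv : `|(r / 2 / (`|v| + 1)) *: v| < r / 2.
  rewrite normrZ gtr0_norm ?divr_gt0// mulrAC ltr_pdivrMr// ltr_pM2l ?divr_gt0//.
  by rewrite ltrDl.
set u := _ *: v in nv *; have Yu : Y u by exact: YZ.
apply/nearly_convex_riP; split; first by apply: hr => //; lra.
exists (r / 2); first by rewrite divr_gt0.
move=> w Yw wr; rewrite -addrA; apply: hr; first exact: YD.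
by apply: le_lt_trans (ler_normD _ _) _; lra.
Qed.

(** * Tangent cones at points of the closure *)

Section TangentCone.
Variable x : X.
Hypothesis Kx : K x.
Local Notation TC := (tangent_cone K x).

Let S := \bigcup_(h in [set h : R | 0 < h]) [set h *: (y - x) | y in K].

Let SD u v : S u -> S v -> S (u + v).
Proof.
move=> [a /= a0 [y Ky <-]] [b /= b0 [z Kz <-]].
have ab0 : 0 < a + b by rewrite addr_gt0.
have /convex_setP cK := nearly_convex_closure.
exists (a + b) => //; exists ((a / (a + b)) *: y + (b / (a + b)) *: z).
  by apply: cK => //; rewrite ?divr_ge0 ?ltW//; field; rewrite gt_eqF.
by apply: pairing_inj => f; rewrite !pairingE; field; rewrite gt_eqF.
Qed.

Let SZ a u : 0 < a -> S u -> S (a *: u).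
Proof.
move=> a0 [b /= b0 [y Ky <-]]; exists (a * b); first by rewrite /= mulr_gt0.
by exists y; rewrite ?scalerA.
Qed.

Lemma tangent_coneB y : K y -> TC (y - x).
Proof.
by move=> Ky; apply: subset_closure; exists 1 => //=; exists y => //; rewrite scale1r.
Qed.

Lemma tangent_cone_convex_cone : convex_cone TC.
Proof.
split=> [|u v Tu Tv|a u a0 Tu].
- by rewrite -(subrr x); exact: tangent_coneB.
- rewrite -[u]scale1r -[v]scale1r; apply: closure_lincomb => // y z Sy Sz.
  by rewrite !scale1r; exact: SD.
- rewrite -[a *: u]addr0 -(scale0r u); apply: closure_lincomb => // y z Sy Sz.
  by rewrite scale0r addr0; exact: SZ.
Qed.

Lemma tangent_cone_direction : TC `<=` Y.
Proof.
apply: closure_sub_closed; first exact: closed_direction.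
move=> _ [h /= h0 [y Ky <-]].
by apply: YZ; exact: direction_closureB.
Qed.

Let tangent_cone_hull : closure (affine_hull TC) = Y.
Proof.
apply/seteqP; split.
  apply: closure_affine_hull_sub; [|exact: closed_direction|exact: tangent_cone_direction].
  by move=> u v t Yu Yv; apply: YD => //; exact: YZ.
move=> w Yw; apply: subset_closure.
have [y ry] := ri_neq0; have [t t0 rw] := ri_direction ry Yw.
have aT := @affine_affine_hull _ _ TC.
have hT z : ri D z -> affine_hull TC (z - x).
  move=> /ri_sub Dz; apply: sub_affine_hull; apply: tangent_coneB.
  exact: subset_closure.
have h0 : affine_hull TC 0.
  by rewrite -(subrr x); apply: sub_affine_hull; exact: tangent_coneB.
(* [w] is a multiple of the midpoint of [y + t *: w - x] and [- (y - x)]. *)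
have -> : w = (1 - 2 / t) *: 0 + (2 / t) *: ((1 - 2^-1) *: (y + t *: w - x) +
    2^-1 *: ((1 - 2) *: (y - x) + 2 *: 0)).
  by apply: pairing_inj => f; rewrite !pairingE !pairing0l; field; rewrite gt_eqF.
apply: (aT) => //; apply: (aT); first exact: hT.
by apply: (aT) => //; exact: hT.
Qed.

(** The ball around [y] in [K] yields a ball around [e *: (y - x)] in the tangent cone, and the cone
    is stable under adding [u]. *)
Lemma tangent_cone_ri u y e : TC u -> ri D y -> 0 < e ->
  ri TC (u + e *: (y - x)).
Proof.
move=> Tu /nearly_convex_riP[Ky [r r0 hr]] e0.
have [_ TD TZ] := tangent_cone_convex_cone.
apply/riP; rewrite tangent_cone_hull.
have Yu : Y (u + e *: (y - x)).
  apply: YD; first exact: tangent_cone_direction.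
  by apply: YZ; exact: direction_closureB.
split=> //; exists (e * r); first by rewrite mulr_gt0.
move=> w Yw wr; pose v := w - (u + e *: (y - x)).
have -> : w = u + e *: (y + e^-1 *: v - x).
  by apply: pairing_inj => f; rewrite !pairingE; field; rewrite gt_eqF.
apply: TD => //; apply: TZ => //; apply: tangent_coneB; apply: hr.
  by apply: YZ; exact: YB.
by rewrite normrZ gtr0_norm ?invr_gt0// ltr_pdivrMl.
Qed.

(** For small [d] the vector [v - d *: (y - x)] is still tangent, so it is [h *: (k - x)] up to an
    error [w]. Moving [y] by [d^-1 *: w] within its ball absorbs the error, and a multiple of [v]
    leads from [x] to the segment between [k] and the moved point. *)
Lemma ri_tangent_cone v : ri TC v -> exists2 s : R, 0 < s & ri D (x + s *: v).
Proof.
move=> /riP; rewrite tangent_cone_hull => -[Yv [e e0 hv]].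
have [y ry] := ri_neq0; have /nearly_convex_riP[Ky [r r0 hr]] := ry.
have Yyx : Y (y - x) by exact: direction_closureB.
pose d : R := e / (`|y - x| + 1).
have d0 : 0 < d by rewrite divr_gt0// ltr_wpDl.
have : TC (v - d *: (y - x)).
  apply: hv; first by apply: YB => //; exact: YZ.
  rewrite addrAC subrr add0r normrN normrZ gtr0_norm//.
  by rewrite mulrAC ltr_pdivrMr ?ltr_wpDl// ltr_pM2l// ltrDl.
have dr0 : 0 < d * r by rewrite mulr_gt0.
move=> /closure_normP /(_ _ dr0)[_ [h /= h0 [k Kk <-]]] hk.
set w := _ - _ in hk; have Yw : Y w.
  apply: YB; last first.
    by apply: YZ; exact: direction_closureB.
  by apply: YB => //; exact: YZ.
have Ydw : Y (d^-1 *: w) by exact: YZ.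
have dwr : `|d^-1 *: w| < r.
  by rewrite normrZ gtr0_norm ?invr_gt0// ltr_pdivrMl.
have rz : ri D (y + d^-1 *: w).
  apply/nearly_convex_riP; split; first exact: hr.
  exists (r - `|d^-1 *: w|); first by rewrite subr_gt0.
  move=> w' Yw' wr'; rewrite -addrA; apply: hr; first exact: YD.
  by apply: le_lt_trans (ler_normD _ _) _; lra.
have hd : 0 < h + d by rewrite addr_gt0.
exists (h + d)^-1; first by rewrite invr_gt0.
have -> : x + (h + d)^-1 *: v = k + (d / (h + d)) *: (y + d^-1 *: w - k).
  by apply: pairing_inj => f; rewrite !pairingE; field; rewrite !gt_eqF.
apply: ri_segment => //; first by rewrite divr_gt0.
by rewrite ler_pdivrMr// mul1r lerDr ltW.
Qed.

End TangentCone.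

End NearlyConvex.

(** * Monotone operators *)

Section MonotoneOperators.
Context {R : realType} {X : completeNormedModType R}.
Implicit Types (x y z u v w : X) (f g n : dual X) (S : set X).

Variable T : X -> set (dual X).
Local Notation D := (domain T).
Local Notation K := (closure D).

Definition monotonically_related x f :=
  forall y g, T y g -> 0 <= <[x - y, f - g]>.

Lemma demiclosed_sub S S' : S `<=` S' -> demiclosed T S' -> demiclosed T S.
Proof.
move=> SS' dT I le x_ f_ x f dle Tf xx ff fM Sx.
exact: (dT I le x_ f_ x f dle Tf xx ff fM (SS' x Sx)).
Qed.

Lemma sum_normal_coneP : T = sum_op T (normal_cone D) ->
  forall x f n, T x f -> (forall y, D y -> <[y - x, n]> <= 0) -> T x (f + n).
Proof.
move=> TE x f n Tf hn; rewrite TE; exists f => //; exists n => //.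
by split=> //; exists f.
Qed.

Lemma ray_le (a b c : R) : (forall t : R, 0 < t -> a + t * b <= c) -> b <= 0.
Proof.
move=> h; rewrite leNgt; apply/negP => b0.
have t0 : 0 < (`|c - a| + 1) / b by rewrite divr_gt0// ltr_wpDl.
have := h _ t0; rewrite divfK ?gt_eqF//; have := ler_norm (c - a); lra.
Qed.

(** By (C), [T x] contains the ray from [f] in the direction [n], and [u] is bounded above on it. *)
Lemma sum_normal_cone_bounded : T = sum_op T (normal_cone D) ->
  forall x f n u (c : R), T x f -> (forall y, D y -> <[y - x, n]> <= 0) ->
  (forall g, T x g -> <[u, g]> <= c) -> <[u, n]> <= 0.
Proof.
move=> TE x f n u c Tf hn uc; apply: (@ray_le <[u, f]> _ c) => t t0.
have := uc (f + t *: n); rewrite pairingDr pairingZr; apply.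
apply: sum_normal_coneP => // y Dy; rewrite pairingZr.
by rewrite pmulr_rle0// hn.
Qed.

(** Serves both implications: it gives (H') for a maximal operator and treats the points of [ri D]
    in the converse. *)
Lemma demiclosed_selection x v (s b : R) :
  monotone_op T -> nearly_convex D -> T = sum_op T (normal_cone D) ->
  demiclosed T [set x] -> K x -> 0 < s -> ri D (x + s *: v) ->
  (forall h f, 0 < h -> h <= s -> T (x + h *: v) f -> b <= <[v, f]>) ->
  exists2 f, T x f & b <= <[v, f]>.
Proof.
move=> mT ncD TE dT Kx s0 rs hb.
have sY := direction_subspace (nearly_convex_neq0 ncD).
have Yv : direction D v.
  have -> : v = s^-1 *: (x + s *: v - x).
    by apply: pairing_inj => f; rewrite !pairingE; field; rewrite gt_eqF.
  apply: (linear_subspaceZ _ sY); apply: direction_closureB => //.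
  exact: subset_closure (ri_sub rs).
have rh h : 0 < h -> h <= s -> D (x + h *: v).
  move=> h0 hs; apply: ri_sub.
  have -> : x + h *: v = x + (h / s) *: (x + s *: v - x).
    by apply: pairing_inj => f; rewrite !pairingE; field; rewrite gt_eqF.
  by apply: ri_segment => //; rewrite ?divr_gt0// ler_pdivrMr// mul1r.
pose F := [set f | exists h, [/\ 0 < h, h <= s & T (x + h *: v) f]].
(* Pointwise bound in the direction [w]: compare [f] with a fixed [g] at [x + s *: v + t *: w]. The
   term in [v] is controlled by [b], independently of [h] and [f]. *)
have [|M M0 FM] := @banach_steinhaus_subspace _ _ (direction D) F sY
  (closed_direction (S := D)).
  move=> w Yw; have [t t0 /(ri_sub (D := D))[g Tg]] := ri_direction ncD rs Yw.
  exists (t^-1 * (s * `|<[v, g]> - b| + t * <[w, g]>)) => f [h [h0 hs Tf]].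
  rewrite ler_pdivlMl//.
  have := mT _ _ _ _ Tf Tg; rewrite !pairingBr !pairingE.
  have h1 : (s - h) * (<[v, g]> - <[v, f]>) <= s * `|<[v, g]> - b|.
    apply: (@le_trans _ _ ((s - h) * `|<[v, g]> - b|)).
      apply: ler_wpM2l; first by rewrite subr_ge0.
      by have := ler_norm (<[v, g]> - b); have := hb h f h0 hs Tf; lra.
    by apply: ler_wpM2r => //; lra.
  lra.
pose I := {h : R | 0 < h /\ h <= s}.
(* The extension [g] agrees with [f] on the direction of [D], so [g - f] is normal to [D] and (C)
   keeps [g] in [T]; the bound now holds on all of [X]. *)
have sel (i : I) : {g | [/\ T (x + sval i *: v) g, b <= <[v, g]> &
    forall y, `|<[y, g]>| <= M * `|y|]}.
  apply: cid; case: i => h /= [h0 hs]; have [f Tf] := rh h h0 hs.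
  have Ff : F f by exists h.
  have [|g [gf gM]] := dual_extension (f := f) sY M0.
    by move=> y; exact: FM.
  exists g; split=> //; last by rewrite gf//; exact: hb Tf.
  have := sum_normal_coneP TE (n := g - f) Tf.
  rewrite (addrCA f) subrr addr0; apply=> y Dy.
  rewrite pairingBr gf ?subrr//; apply: direction_closureB.
    exact: subset_closure.
  by apply: subset_closure; exists f.
pose G (d : R) : set I := [set i | sval i < d].
(* The filter of [h] tending to [0] from the right, refined below to an ultrafilter. *)
have FG : ProperFilter (filter_from [set d : R | 0 < d] G).
  apply: filter_from_proper.
    apply: filter_from_filter; first by exists 1 => /=.
    move=> d e /= d0 e0; exists (Num.min d e); first by rewrite /= lt_min d0.
    by move=> i; rewrite /G /= lt_min => /andP[].
  move=> d /= d0; pose h := Num.min (d / 2) s.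
  have h0 : 0 < h by rewrite lt_min s0 divr_gt0.
  have hs : h <= s by rewrite ge_min lexx orbT.
  have hd : h < d by rewrite gt_min; apply/orP; left; lra.
  by exists (exist _ h (conj h0 hs)).
have [U [UU GU]] := ultraFilterLemma FG.
have selM i y : `|<[y, sval (sel i)]>| <= M * `|y| by have [_ _] := svalP (sel i).
have [f Uf] := bounded_ultrafilter_cvg UU selM.
have xU : (x + sval i *: v) @[i --> U] --> x.
  apply/cvgrPdist_lt => e e0; apply: GU.
  exists (e / (`|v| + 1)); first by rewrite /= divr_gt0// ltr_wpDl.
  move=> [h [h0 hs]]; rewrite /G /= => he.
  rewrite opprD addrA subrr add0r normrN normrZ gtr0_norm//.
  apply: (@le_lt_trans _ _ (h * (`|v| + 1))).
    by rewrite ler_pM2l// lerDl.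
  by rewrite -ltr_pdivlMr// ltr_wpDl.
exists f.
  apply: (@demiclosed_filter _ _ T [set x] I U (fun i => x + sval i *: v)
    (fun i => sval (sel i)) M) => // [i|]; last exact: ltW.
  by have [] := svalP (sel i).
apply: cvgr_to_ge (Uf v) _; near=> i; by have [] := svalP (sel i).
Unshelve. all: by end_near. Qed.

(** * Properties of maximal monotone operators *)

Section Maximal.
Hypothesis maxT : maximal_monotone T.

(** Adding the pair to the graph keeps it monotone. *)
Lemma maximal_monotone_related x f : monotonically_related x f -> T x f.
Proof.
have [mT max] := maxT => xf.
pose T' y := [set g | T y g \/ y = x /\ g = f].
rewrite -[T](max T'); first by right.
  move=> x1 x2 f1 f2 [T1|[-> ->]] [T2|[-> ->]].
  - exact: mT.
  - rewrite -opprB pairingNl -[f1 - f]opprB -[- (f - f1)]scaleN1r pairingZr.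
    by rewrite mulN1r opprK; exact: xf.
  - exact: xf.
  - by rewrite subrr pairing0l.
by move=> y g; left.
Qed.

(** Normal vectors at two points of the domain pair nonnegatively with the difference of the points,
    so the sum is a monotone extension of [T]. *)
Lemma maximal_monotone_sum_normal_cone : T = sum_op T (normal_cone D).
Proof.
have [mT max] := maxT; apply/esym/max.
  move=> x1 x2 _ _ [f1 T1 [n1 [D1 N1] <-]] [f2 T2 [n2 [D2 N2] <-]].
  have := mT _ _ _ _ T1 T2; have := N1 _ D2; have := N2 _ D1.
  rewrite !pairingBr !pairingDr !pairingE; lra.
move=> x f Tf; exists f => //; exists 0; rewrite ?addr0//.
by split=> [|y _]; [exists f|rewrite pairing0r].
Qed.

Lemma maximal_monotone_weak_star_closed x : closed (T x : set (weak_star X)).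
Proof.
move=> f clf; apply: maximal_monotone_related => y g Tg.
have [mT _] := maxT.
pose F : set_system (dual X) := within (T x) (nbhs (f : weak_star X)).
have FF : ProperFilter F := within_nbhs_proper clf.
have /weak_star_cvgP/(_ (x - y)) h : F --> (f : weak_star X).
  exact: cvg_within.
rewrite pairingBr subr_ge0; apply: cvgr_to_ge h _.
apply: (@filterS _ (nbhs (f : weak_star X)) _ setT) => [h _ Th|]; last exact: filterT.
by have := mT _ _ _ _ Th Tg; rewrite pairingBr subr_ge0.
Qed.

Lemma maximal_monotone_convex x : convex_set (T x).
Proof.
have [mT _] := maxT.
apply/convex_setP => f g s t s0 t0 st Tf Tg; apply: maximal_monotone_related.
move=> y h Th.
have := mulr_ge0 s0 (mT _ _ _ _ Tf Th); have := mulr_ge0 t0 (mT _ _ _ _ Tg Th).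
rewrite !pairingBr pairingDr !pairingZr => h1 h2.
have -> : <[x - y, h]> = (s + t) * <[x - y, h]> by rewrite st mul1r.
lra.
Qed.

(** Write [x_ i - y] as [(x_ i - x) + (x - y)]. Against [f_ i - g] the first part tends to [0] by
    the norm bound, the second converges weakly-star, and monotonicity passes to the limit. *)
Lemma maximal_monotone_demiclosed S : demiclosed T S.
Proof.
move=> I le x_ f_ x f [[i0] lexx letr ledir] Tf_ xx ff [M fM] _.
apply: maximal_monotone_related => y g Tg; have [mT _] := maxT.
have Ft : ProperFilter (tails le).
  split; first by move=> [i /(_ i (lexx i))].
  split=> [|P Q [p hp] [q hq]|P Q PQ [p hp]].
  - by exists i0.
  - have [r [pr qr]] := ledir p q; exists r => k rk.
    by split; [apply: hp; exact: letr rk|apply: hq; exact: letr rk].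
  - by exists p => r /hp /PQ.
have M0 : 0 <= M + dual_norm g.
  apply: addr_ge0; first exact: le_trans (dual_norm_ge0 _) (fM i0).
  exact: dual_norm_ge0.
have ffP : forall u, <[u, f_ i]> @[i --> tails le] --> <[u, f]>.
  move=> u; by have /weak_star_cvgP/(_ u) := ff.
have l1 : (<[x - y, f_ i]> - <[x - y, g]>) @[i --> tails le] -->
    <[x - y, f]> - <[x - y, g]>.
  by apply: cvgB; [exact: ffP|exact: cvg_cst].
have l2 : (`|x_ i - x| * (M + dual_norm g)) @[i --> tails le] --> (0 : R).
  rewrite -(mul0r (M + dual_norm g)) -(normr0 X) -(subrr x); apply: cvgMl.
  by apply: cvg_norm; apply: cvgB => //; exact: cvg_cst.
have := cvgD l1 l2; rewrite addr0 -pairingBr => l3.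
apply: cvgr_to_ge (l3 _) _; apply: nearW => i.
have := mT _ _ _ _ (Tf_ i) Tg.
have -> : x_ i - y = (x_ i - x) + (x - y) by rewrite addrA subrK.
rewrite pairingDl [<[x - y, _]>]pairingBr.
have h1 : <[x_ i - x, f_ i - g]> <= `|x_ i - x| * (M + dual_norm g).
  rewrite pairingBr mulrDr; apply: le_trans (ler_norm _) _.
  apply: le_trans (ler_normB _ _) _; apply: lerD; rewrite mulrC.
    by apply: le_trans (pairing_dual_norm _ _) _; apply: ler_wpM2r.
  exact: pairing_dual_norm.
by rewrite fctE /=; lra.
Qed.

End Maximal.

(** The form in which (H') is applied. If [T z] is empty, every [b] is an upper bound. *)
Lemma radial_inf_lt z v (b c : R) :
  (ereal_inf [set ereal_inf [set <[v, f]>%R%:E | f in T (z + h *: v)%R]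
                    | h in [set h : R | (0 < h)%R]]
          <= ereal_sup [set <[v, f]>%R%:E | f in T z])%E ->
  (forall f, T z f -> <[v, f]> <= b) -> b < c ->
  exists h g, [/\ 0 < h, T (z + h *: v) g & <[v, g]> < c].
Proof.
move=> H hb bc.
have supb : (ereal_sup [set <[v, f]>%:E | f in T z] <= b%:E)%E.
  by apply: ge_ereal_sup => _ [f Tf <-]; rewrite lee_fin; exact: hb.
have : (ereal_inf [set ereal_inf [set <[v, f]>%R%:E | f in T (z + h *: v)%R]
                    | h in [set h : R | (0 < h)%R]] < c%:E)%E.
  by apply: le_lt_trans (le_trans H supb) _; rewrite lte_fin.
move=> /ereal_inf_lt[_ [h /= h0 <-]] /ereal_inf_lt[_ [g Tg <-]].
by rewrite lte_fin => ?; exists h, g.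
Qed.

End MonotoneOperators.

(** [z] is the last point of [closure D] on the segment from [y] to [x]; at a relative interior
    point the segment could be continued within [D]. *)
Lemma ri_boundary_point {R : realType} {X : normedModType R} (D : set X) x y :
  nearly_convex D -> ri D y -> closure (affine_hull D) x -> ~ closure D x ->
  exists z (k : R), [/\ closure D z, ~ ri D z, 0 < k & x - z = - k *: (y - z)].
Proof.
move=> ncD ry Ax Kx; have Ky : closure D y by exact: subset_closure (ri_sub ry).
have /convex_setP cK := nearly_convex_closure ncD.
pose p (t : R) := y + t *: (x - y).
pose E := [set t : R | 0 <= t /\ closure D (p t)].
have E0 : E 0 by split=> //; rewrite /p scale0r addr0.
have E1 t : E t -> t <= 1.
  move=> [t0 Kt]; rewrite leNgt; apply/negP => t1; apply: Kx.
  have tp : 0 < t by rewrite (lt_trans ltr01).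
  have -> : x = (1 - t^-1) *: y + t^-1 *: p t.
    by apply: pairing_inj => f; rewrite !pairingE; field; rewrite gt_eqF.
  apply: cK => //; rewrite ?invr_ge0// ?subrK// subr_ge0 invf_le1 ?ltW//.
have supE : has_sup E by split; [exists 0|exists 1].
pose s := sup E.
have s0 : 0 <= s by apply: ub_le_sup => //; exact: supE.2.
have s1 : s <= 1 by apply: ge_sup => //; exists 0.
have Kz : closure D (p s).
  suff : closure (closure D) (p s) by move/closed_closure.
  apply/closure_normP => e e0.
  have d0 : 0 < e / (`|x - y| + 1) by rewrite divr_gt0// ltr_wpDl.
  have [t [t0 Kt] st] := sup_adherent d0 supE.
  have ts : t <= s by apply: ub_le_sup => //; exact: supE.2.
  exists (p t) => //; rewrite /p opprD addrACA subrr add0r -scalerBl normrZ.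
  rewrite ger0_norm ?subr_ge0//.
  apply: (@le_lt_trans _ _ ((s - t) * (`|x - y| + 1))).
    by apply: ler_wpM2l; [rewrite subr_ge0|rewrite lerDl].
  by rewrite -ltr_pdivlMr ?ltr_wpDl//; rewrite -/s in st; lra.
have nri : ~ ri D (p s).
  move=> rz; have Yxy : direction D (x - y).
    by apply: directionB => //; exact: closure_sub_affine_hull.
  have [d d0 rd] := ri_direction ncD rz Yxy.
  have : s + d <= s.
    apply: ub_le_sup; first exact: supE.2.
    split; first by rewrite addr_ge0// ltW.
    by rewrite /p scalerDl addrA; exact: subset_closure (ri_sub rd).
  by lra.
have sp : 0 < s.
  rewrite lt_neqAle s0 andbT; apply/eqP => s00; apply: nri.
  by rewrite -s00 /p scale0r addr0.
have s1' : s < 1.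
  rewrite lt_neqAle s1 andbT; apply/eqP => s11; apply: Kx.
  by move: Kz; rewrite s11 /p scale1r addrCA subrr addr0.
exists (p s), ((1 - s) / s); split=> //; first by rewrite divr_gt0// subr_gt0.
by apply: pairing_inj => f; rewrite !pairingE; field; rewrite gt_eqF.
Qed.

(** * Sufficiency: pairs monotonically related to the graph belong to it *)

Section Sufficiency.
Context {R : realType} {X : completeNormedModType R}.
Variable T : X -> set (dual X).
Local Notation D := (domain T).
Local Notation K := (closure D).
Hypotheses (mT : monotone_op T) (ncD : nearly_convex D).
Hypothesis TN : T = sum_op T (normal_cone D).
Hypothesis Tclosed : forall x, D x ->
  closed (T x : set (weak_star X)) /\ convex_set (T x).
Hypothesis Tradial : forall x, (K `\` ri D) x ->
  forall v, ri (tangent_cone K x) v ->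
  (ereal_inf [set ereal_inf [set <[v, f]>%R%:E | f in T (x + h *: v)%R]
                    | h in [set h : R | (0 < h)%R]]
          <= ereal_sup [set <[v, f]>%R%:E | f in T x])%E.
Hypothesis Tdemiclosed : demiclosed T (ri D).

Let sY : linear_subspace (direction D) := direction_subspace (nearly_convex_neq0 ncD).

(** Relatedness bounds [x - y] above on [T y] by its value at [f]. *)
Lemma related_normal_cone x f y g n : monotonically_related T x f -> T y g ->
  (forall z, D z -> <[z - y, n]> <= 0) -> <[x - y, n]> <= 0.
Proof.
move=> xf Tg yn; apply: (sum_normal_cone_bounded TN (c := <[x - y, f]>) Tg yn).
by move=> h /xf; rewrite pairingBr subr_ge0.
Qed.

Lemma related_radial x f h v g : monotonically_related T x f -> 0 < h ->
  T (x + h *: v) g -> <[v, f]> <= <[v, g]>.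
Proof.
move=> xf h0 /xf; rewrite opprD addrA subrr add0r pairingNl pairingZl.
by rewrite oppr_ge0 pmulr_rle0// pairingBr subr_le0.
Qed.

(** A functional that separates [x - y] from the direction of [D] would be normal to [D] at [y] and
    positive at [x - y]. *)
Lemma related_affine_hull x f :
  monotonically_related T x f -> closure (affine_hull D) x.
Proof.
move=> xf; have [y Dy] := nearly_convex_neq0 ncD; have [g Tg] := Dy.
have Ky := subset_closure Dy.
apply: contrapT => Ax; have Yxy : ~ direction D (x - y).
  move=> Yxy; apply: Ax; have := Yxy y (closure_sub_affine_hull Ky).
  by rewrite addrCA subrr addr0.
have cY : convex_cone (direction D).
  split=> [|u v|a u _]; [exact: sY.1|exact: linear_subspaceD sY|].
  exact: linear_subspaceZ sY.
have [n [nY]] := separate_closed_cone (closed_direction (S := D)) cY Yxy.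
apply/negP; rewrite -leNgt; apply: related_normal_cone xf Tg _ => z Dz.
by apply: nY; apply: direction_closureB => //; exact: subset_closure.
Qed.

Lemma related_closure x f : monotonically_related T x f -> K x.
Proof.
move=> xf; apply: contrapT => Kx; have [y ry] := ri_neq0 ncD.
have [z [k [Kz rz k0 xz]]] := ri_boundary_point ncD ry (related_affine_hull xf) Kx.
have [ncone _ _] := tangent_cone_convex_cone ncD Kz.
have rv : ri (tangent_cone K z) (y - z).
  by have := tangent_cone_ri ncD Kz ncone ry ltr01; rewrite add0r scale1r.
have [[g Tg]|Dz] := pselect (D z).
  (* Otherwise adding [y - z] would put [0] in the relative interior of the tangent cone, and [z] in
     [ri D]. *)
  have Tv : ~ tangent_cone K z (- (y - z)).
    move=> Tv; have := tangent_cone_ri ncD Kz Tv ry ltr01.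
    rewrite scale1r addNr => /(ri_tangent_cone ncD Kz)[s _].
    by rewrite scaler0 addr0.
  have [n [nT]] := separate_closed_cone (@closed_closure _ _)
    (tangent_cone_convex_cone ncD Kz) Tv.
  rewrite pairingNl oppr_gt0; apply/negP; rewrite -leNgt.
  have : <[x - z, n]> <= 0.
    apply: related_normal_cone xf Tg _ => w Dw; apply: nT.
    by apply: tangent_coneB; exact: subset_closure.
  by rewrite xz pairingZl mulNr oppr_le0 pmulr_rge0.
(* [x] lies on the line through [z] and [y], on the side of [z] opposite to [y], so relatedness at
   [z + h *: (y - z)] contradicts the strict inequality for [g]. *)
have [|||h [g [h0 Tg]]] :=
  @radial_inf_lt _ _ T z (y - z) (<[y - z, f]> - 1) <[y - z, f]>.
- exact: Tradial.
- by move=> g Tg; case: Dz; exists g.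
- lra.
apply/negP; rewrite -leNgt.
have := xf _ _ Tg; rewrite opprD addrA xz -scalerBl pairingZl pairingBr.
by rewrite nmulr_rge0 ?subr_le0//; lra.
Qed.

Lemma related_mem x f : monotonically_related T x f -> T x f.
Proof.
move=> xf; have Kx := related_closure xf; apply: contrapT => Tf.
have [y ry] := ri_neq0 ncD; have Dy := ri_sub ry.
have [ncone _ _] := tangent_cone_convex_cone ncD Kx.
have [Dx|Dx] := pselect (D x); last first.
  have rv : ri (tangent_cone K x) (y - x).
    by have := tangent_cone_ri ncD Kx ncone ry ltr01; rewrite add0r scale1r.
  have [|||h [g [h0 Tg]]] :=
    @radial_inf_lt _ _ T x (y - x) (<[y - x, f]> - 1) <[y - x, f]>.
  - by apply: Tradial => //; split=> // /ri_sub.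
  - by move=> g Tg; case: Dx; exists g.
  - lra.
  by apply/negP; rewrite -leNgt; exact: related_radial xf h0 Tg.
have [clT cT] := Tclosed Dx.
have [u uf] := weak_star_separation clT cT Dx Tf.
(* Otherwise some [n] normal to [D] at [x] is positive at [u], although [u] is bounded above on
   [T x]. *)
have Tu : tangent_cone K x u.
  apply: contrapT => Tu; have [g Tg] := Dx.
  have [n [nT]] := separate_closed_cone (@closed_closure _ _)
    (tangent_cone_convex_cone ncD Kx) Tu.
  apply/negP; rewrite -leNgt.
  apply: (sum_normal_cone_bounded TN (c := <[u, f]> - 1) Tg).
    move=> w Dw; apply: nT; apply: tangent_coneB; exact: subset_closure.
  by move=> h /uf; rewrite lerBrDr.
have [rx|rx] := pselect (ri D x).
  have [s s0 rs] := ri_direction ncD rx (tangent_cone_direction ncD Kx Tu).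
  have dx : demiclosed T [set x] by apply: demiclosed_sub Tdemiclosed => _ ->.
  have [|g Tg] := demiclosed_selection (b := <[u, f]>) mT ncD TN dx Kx s0 rs.
    by move=> h g h0 _ Tg; exact: related_radial xf h0 Tg.
  by have := uf _ Tg; lra.
have [g0 Tg0] := Dy.
(* On [T x], monotonicity against [g0] bounds [u + e *: (y - x)] by [<[u, f]> - 1 + e *
   <[y - x, g0]>]; this is below its value at [f] exactly when [e * c < 1]. *)
pose c := <[y - x, g0]> - <[y - x, f]>; pose e := (`|c| + 1)^-1.
have c1 : 0 < `|c| + 1 by rewrite ltr_wpDl.
have e0 : 0 < e by rewrite invr_gt0.
have ec : e * c < 1.
  by rewrite /e mulrC ltr_pdivrMr// mul1r; have := ler_norm c; lra.
have rv := tangent_cone_ri ncD Kx Tu ry e0.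
have [|||h [g [h0 Tg]]] := @radial_inf_lt _ _ T x (u + e *: (y - x))
  (<[u, f]> - 1 + e * <[y - x, g0]>) <[u + e *: (y - x), f]>.
- by apply: Tradial.
- move=> g Tg; rewrite (pairingDl u) pairingZl; apply: lerD.
    by rewrite lerBrDr uf.
  rewrite ler_pM2l//; have := mT Tg0 Tg.
  by rewrite pairingBr subr_ge0.
- rewrite (pairingDl u) pairingZl; move: ec; rewrite /c mulrBr; lra.
by apply/negP; rewrite -leNgt; exact: related_radial xf h0 Tg.
Qed.

End Sufficiency.

Theorem theorem26 (R : realType) (X : completeNormedModType R)
    (T : X -> set (dual X))
    (dimX : dim_gt1 X)
    (T_nonempty : exists x f, T x f)
    (T_monotone : monotone_op T)
    (DT_nearly_convex : nearly_convex (domain T))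
    (DT_not_singleton : ~ exists a, domain T = [set a]) :
  maximal_monotone T <->
  [/\ (* (C) *)
      T = sum_op T (normal_cone (domain T)),
      (* (H') *)
      (forall x, domain T x ->
         closed (T x : set (weak_star X)) /\ convex_set (T x)) /\
      (forall x, (closure (domain T) `\` ri (domain T)) x ->
       forall v, ri (tangent_cone (closure (domain T)) x) v ->
         (ereal_inf [set ereal_inf [set <[v, f]>%R%:E | f in T (x + h *: v)%R]
                    | h in [set h : R | (0 < h)%R]]
          <= ereal_sup [set <[v, f]>%R%:E | f in T x])%E)
    & (* (D') *)
      demiclosed T (ri (domain T))].
Proof.
split=> [maxT|[TN [Tclosed Tradial] Tdemi]].
  have TN := maximal_monotone_sum_normal_cone maxT.
  split=> //; last exact: maximal_monotone_demiclosed.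
  split=> [x _|x [Kx rx] v rv].
    split; first exact: maximal_monotone_weak_star_closed.
    exact: maximal_monotone_convex.
  have [s s0 rs] := ri_tangent_cone DT_nearly_convex Kx rv.
  set I := ereal_inf _; set S := ereal_sup _; rewrite leNgt; apply/negP => SI.
  have Ile h f : 0 < h -> T (x + h *: v) f -> (I <= <[v, f]>%:E)%E.
    move=> h0 Tf; apply: le_trans (ereal_inf_lbound _) (ereal_inf_lbound _).
      by exists h.
    by exists f.
  have [g Tg] := ri_sub rs.
  (* The infimum exceeds [S], so it is not [-oo]; the value at [g] keeps it from being [+oo]. *)
  have [b Ib] : exists b : R, I = b%:E.
    case: I SI Ile => [b _ _|_ /(_ s g s0 Tg)//|]; first by exists b.
    by rewrite ltNge leNye.
  have [|f Tf bf] := demiclosed_selection (b := b) T_monotone DT_nearly_convex TN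
    (@maximal_monotone_demiclosed _ _ _ maxT [set x]) Kx s0 rs.
    by move=> h f h0 _ Tf; rewrite -lee_fin -Ib; exact: Ile h0 Tf.
  have : (S < S)%E.
    apply: lt_le_trans SI _; rewrite Ib; apply: (@le_trans _ _ <[v, f]>%:E).
      by rewrite lee_fin.
    by apply: ereal_sup_ubound; exists f.
  by rewrite ltxx.
split=> // T' mT' TT'; apply/funext => x; apply/seteqP; split; last exact: TT'.
move=> f T'f; apply: related_mem => // y g /TT' T'g.
exact: mT'.
Qed.
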